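(* Let $p$ be a prime with $p\equiv 1\pmod 3$, and write $p=x^2+3y^2$ with integers $x,y$. Then $$\sum_{k=0}^{(p-1)/2}\frac{\binom{2k}k^3}{16^k(k+1)}\equiv -16y^2+2p\pmod{p^2},\qquad \sum_{k=0}^{(p-1)/2}\frac{\binom{2k}k^3}{256^k(k+1)}\equiv(-1)^{\frac{p-1}2}(-8y^2+2p)\pmod{p^2}.$$
   Context: For a prime $p$, congruences modulo $p^r$ between rational numbers whose denominators are prime to $p$ mean that the difference is $p^r$ times a rational number with denominator prime to $p$. *)

(* Defs.v *)
From HB Require Import structures.
From mathcomp Require Import all_boot all_order all_algebra.
Set Implicit Arguments. Unset Strict Implicit. Unset Printing Implicit Defensive.
Import Order.TTheory GRing.Theory Num.Theory.
Local Open Scope ring_scope.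

Definition rat_congr (p r : nat) (a b : rat) : Prop :=
  exists c : rat, a - b = (p ^ r)%N%:R * c /\ coprime `|denq c|%N p.

(* Main.v *)
Require Import Defs.
From HB Require Import structures.
From mathcomp Require Import all_boot all_order all_algebra.
From mathcomp Require Import finfield.
From mathcomp Require Import zify ring lra.
Import Order.TTheory GRing.Theory Num.Theory.
Local Open Scope ring_scope.

(** Let p = 6h + 1 and n = 3h = (p - 1)/2.  Modulo p^2 the summands
    binom(2k,k)^3 / 16^k and binom(2k,k)^3 / 256^k agree with terms of three
    other families, since all the deformations are even in p:

    - binom(n,k) binom(n+k,k) binom(2k,k) t^k with t = -1, -1/16.  By Clausen's
      formula these are the terms of the square of a Legendre polynomial, whose
      differential equation yields a quadratic relation between the sums S_0,
      S_1, F of a_k, k a_k and a_k / (k + 1).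
    - the terms [term16 n k] and [term256 n k] of deformations for
      which the sum, and the sum weighted by 3k + 1 resp. 6k + 1, have closed
      forms (Zeilberger's algorithm).  The weighted sums give S_1 in terms of
      S_0; the plain ones express S_0 through factorials.

    It remains to show S_0 = 4x^2 - 2p.  Harmonic sum congruences identify the
    closed forms with 4^(8hp) binom(4h,2h)^2.  On the other hand, if chi is the
    cubic Teichmueller character, then K = sum_u chi(1 - u^2) is 4^(4hp) times the
    Jacobi sum J(chi,chi), which is - binom(4h,2h) modulo p^2 by expanding
    (1 - tau)^(pA) at Teichmueller representatives tau; the conjugate sum is
    p / K.  Pairing u with - u shows K = a + b sqrt(-3) with integers a, b; the
    congruence a^2 + 3b^2 = p modulo p^2 and the trivial bound force
    a^2 + 3b^2 = p, so a^2 = x^2 and K^2 = 4x^2 - 2p modulo p^2. *)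

(** * Closed forms of the deformed hypergeometric sums *)

Lemma telescope_eq0 (V : zmodType) (f g : nat -> V) (N : nat) :
  (forall k, (k < N)%N -> f k = g k.+1 - g k) -> g 0%N = 0 -> g N = 0 ->
  \sum_(0 <= k < N) f k = 0.
Proof.
move=> fE g0 gN.
rewrite (@eq_big_nat _ _ _ _ _ f (fun k => g k.+1 - g k)) => [|k /andP[_]]; last exact: fE.
by rewrite telescope_sumr // gN g0 subr0.
Qed.

(** With [p = 2n + 1] this is [(2i+1)((2i+1)^2 - p^2) / (2(i+1)((i+1)^2 - p^2))], the term ratio of
    a terminating 3F2 series at 4. It is even in [p], with value [(2i+1)^3 / (2(i+1)^3)] at
    [p = 0]. *)
Definition ratio16 (n i : nat) : rat :=
  2 * (i%:R - n%:R) * (i%:R + n%:R + 1) * (2 * i%:R + 1)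
  / ((i%:R + 1) * (i%:R + 2 * n%:R + 2) * (i%:R - 2 * n%:R)).
Definition term16 (n k : nat) : rat := \prod_(0 <= i < k) ratio16 n i.

(** Here [(4i+2n+5)(4i+3-2n) = 16(i+1)^2 - p^2], so the ratio is again even in [p], now with value
    [(2i+1)^3 / (32(i+1)^3)] at [p = 0]. *)
Definition ratio256 (n i : nat) : rat :=
  2 * (i%:R - n%:R) * (i%:R + n%:R + 1) * (2 * i%:R + 1)
  / ((i%:R + 1) * (4 * i%:R + 2 * n%:R + 5) * (4 * i%:R + 3 - 2 * n%:R)).
Definition term256 (n k : nat) : rat := \prod_(0 <= i < k) ratio256 n i.

Lemma term16S n k : term16 n k.+1 = term16 n k * ratio16 n k.
Proof. by rewrite /term16 big_nat_recr. Qed.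
Lemma term256S n k : term256 n k.+1 = term256 n k * ratio256 n k.
Proof. by rewrite /term256 big_nat_recr. Qed.
Lemma term16_0 n : term16 n 0 = 1. Proof. by rewrite /term16 big_geq. Qed.
Lemma term256_0 n : term256 n 0 = 1. Proof. by rewrite /term256 big_geq. Qed.
(** The factor [i - n] terminates the series, so sums for two values of the parameter can be taken
    over a common range. *)
Lemma term16_last n : term16 n n.+1 = 0.
Proof. by rewrite term16S /ratio16 subrr mulr0 !mul0r mulr0. Qed.
Lemma term256_last n : term256 n n.+1 = 0.
Proof. by rewrite term256S /ratio256 subrr mulr0 !mul0r mulr0. Qed.

(** Raising the parameter only shifts each Pochhammer symbol, hence a rational factor. The bounds on
    [n] and [k] keep [2n + 1 - k] positive. *)
Lemma term16_shift n k : (0 < n)%N -> (k <= n.+1)%N ->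
  term16 n k = term16 n.+1 k *
   ((n%:R + 1 - k%:R) * (2 * n%:R + 2 + k%:R) * (2 * n%:R + 3 + k%:R) * (2 * n%:R + 1)
   / ((n%:R + 1 + k%:R) * (2 * n%:R + 3) * (2 * n%:R + 2 - k%:R) * (2 * n%:R + 1 - k%:R))).
Proof.
move=> n0; have N1 : 1 <= n%:R :> rat by rewrite ler1n.
elim: k => [|k IH] kn.
  by rewrite !term16_0; field; do ! (apply/andP; split); apply: lt0r_neq0; lra.
rewrite !term16S IH ?(ltnW kn) // /ratio16.
have K0 : 0 <= k%:R :> rat by rewrite ler0n.
have KN : k%:R <= n%:R :> rat by rewrite ler_nat -ltnS.
have -> : n.+1%:R = n%:R + 1 :> rat by rewrite -natr1.
have -> : k.+1%:R = k%:R + 1 :> rat by rewrite -natr1.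
by field; do ! (apply/andP; split); (apply: lt0r_neq0; lra) || (apply: ltr0_neq0; lra).
Qed.

Lemma odd_neq_mul4 (n k : nat) : 2 * n%:R + 1 - 4 * k%:R != 0 :> rat.
Proof.
rewrite subr_eq0 -!natrM natr1 eqr_nat; lia.
Qed.

(** The symbols that advance by 4 match only after a shift of [n] by 2, whence the two-step
    recurrences below. The denominator [2n + 1 - 4k] is odd, so it never vanishes. *)
Lemma term256_shift n k :
  term256 n k = term256 n.+2 k *
   ((n%:R + 1 - k%:R) * (n%:R + 2 - k%:R) * (2 * n%:R + 5 + 4 * k%:R) * (2 * n%:R + 1)
   / ((n%:R + 1 + k%:R) * (n%:R + 2 + k%:R) * (2 * n%:R + 5) * (2 * n%:R + 1 - 4 * k%:R))).
Proof.
have N0 : 0 <= n%:R :> rat by rewrite ler0n.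
elim: k => [|k IH].
  by rewrite !term256_0; field; do ! (apply/andP; split); apply: lt0r_neq0; lra.
rewrite !term256S IH /ratio256.
have K0 : 0 <= k%:R :> rat by rewrite ler0n.
have h1 := odd_neq_mul4 n k.
have h2 := odd_neq_mul4 n.+1 k.+1.
have h3 := odd_neq_mul4 n k.+1.
move: h2 h3.
have -> : n.+2%:R = n%:R + 2 :> rat by rewrite -addn2 natrD.
have -> : n.+1%:R = n%:R + 1 :> rat by rewrite -natr1.
have -> : k.+1%:R = k%:R + 1 :> rat by rewrite -natr1.
move=> h2 h3.
field; do ! (apply/andP; split); try (apply: lt0r_neq0; lra).
all: try exact: h1.
all: try by move: h2; apply: contra_neq; lra.
all: try by move: h3; apply: contra_neq; lra.
all: by move: h1; apply: contra_neq; lra.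
Qed.

Lemma term16_sum_rec n : (0 < n)%N ->
  (2 * n%:R + 1) * (3 * n%:R + 4) * (\sum_(0 <= k < n.+2) term16 n.+1 k)
  = (2 * n%:R + 3) * (3 * n%:R + 2) * (\sum_(0 <= k < n.+1) term16 n k).
Proof.
move=> n0; have N1 : 1 <= n%:R :> rat by rewrite ler1n.
have -> : \sum_(0 <= k < n.+1) term16 n k = \sum_(0 <= k < n.+2) term16 n k.
  by rewrite [RHS]big_nat_recr //= term16_last addr0.
apply/eqP; rewrite -subr_eq0 !mulr_sumr -sumrB; apply/eqP.
(* Zeilberger's certificate, as in the three recurrences below. *)
pose g k := - (term16 n.+1 k * k%:R * (2 * n%:R + 3 + k%:R) * (2 * n%:R + 1)
  * (2 * n%:R + 2) / ((n%:R + 1 + k%:R) * (2 * n%:R + 2 - k%:R))).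
apply: (@telescope_eq0 _ _ g); last 2 first.
- by rewrite /g mulr0 !mul0r oppr0.
- by rewrite /g term16_last !mul0r oppr0.
move=> k kn; rewrite /g (term16_shift n k) // term16S /ratio16.
have K0 : 0 <= k%:R :> rat by rewrite ler0n.
have KN : k%:R <= n%:R + 1 :> rat by rewrite natr1 ler_nat -ltnS.
have -> : n.+1%:R = n%:R + 1 :> rat by rewrite -natr1.
have -> : k.+1%:R = k%:R + 1 :> rat by rewrite -natr1.
by field; do ! (apply/andP; split); (apply: lt0r_neq0; lra) || (apply: ltr0_neq0; lra).
Qed.

Lemma term16_lin_sum_rec n : (0 < n)%N ->
  (2 * n%:R + 1) * (\sum_(0 <= k < n.+2) (3 * k%:R + 1) * term16 n.+1 k)
  = (2 * n%:R + 3) * (\sum_(0 <= k < n.+1) (3 * k%:R + 1) * term16 n k).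
Proof.
move=> n0; have N1 : 1 <= n%:R :> rat by rewrite ler1n.
have -> : \sum_(0 <= k < n.+1) (3 * k%:R + 1) * term16 n k
        = \sum_(0 <= k < n.+2) (3 * k%:R + 1) * term16 n k.
  by rewrite [RHS]big_nat_recr //= term16_last mulr0 addr0.
apply/eqP; rewrite -subr_eq0 !mulr_sumr -sumrB; apply/eqP.
pose g k := - (term16 n.+1 k * k%:R * (2 * n%:R + 3 + k%:R) * (2 * n%:R + 1)
  * (2 * k%:R) / ((n%:R + 1 + k%:R) * (2 * n%:R + 2 - k%:R))).
apply: (@telescope_eq0 _ _ g); last 2 first.
- by rewrite /g mulr0 !mul0r oppr0.
- by rewrite /g term16_last !mul0r oppr0.
move=> k kn; rewrite /g (term16_shift n k) // term16S /ratio16.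
have K0 : 0 <= k%:R :> rat by rewrite ler0n.
have KN : k%:R <= n%:R + 1 :> rat by rewrite natr1 ler_nat -ltnS.
have -> : n.+1%:R = n%:R + 1 :> rat by rewrite -natr1.
have -> : k.+1%:R = k%:R + 1 :> rat by rewrite -natr1.
by field; do ! (apply/andP; split); (apply: lt0r_neq0; lra) || (apply: ltr0_neq0; lra).
Qed.

Lemma term256_sum_rec n :
  (2 * n%:R + 1) * (6 * n%:R + 13) * (\sum_(0 <= k < n.+3) term256 n.+2 k)
  = (2 * n%:R + 5) * (6 * n%:R + 5) * (\sum_(0 <= k < n.+1) term256 n k).
Proof.
have N0 : 0 <= n%:R :> rat by rewrite ler0n.
have -> : \sum_(0 <= k < n.+1) term256 n k = \sum_(0 <= k < n.+3) term256 n k.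
  rewrite [RHS]big_nat_recr //= [in RHS]big_nat_recr //= (term256S n n.+1).
  by rewrite !term256_last mul0r !addr0.
apply/eqP; rewrite -subr_eq0 !mulr_sumr -sumrB; apply/eqP.
pose g k := - (term256 n.+2 k * k%:R * (2 * n%:R + 5 + 4 * k%:R) * (2 * n%:R + 1)
  * (2 * (2 * n%:R + 3)) / ((n%:R + 1 + k%:R) * (n%:R + 2 + k%:R))).
apply: (@telescope_eq0 _ _ g); last 2 first.
- by rewrite /g mulr0 !mul0r oppr0.
- by rewrite /g term256_last !mul0r oppr0.
move=> k kn; rewrite /g (term256_shift n k) term256S /ratio256.
have K0 : 0 <= k%:R :> rat by rewrite ler0n.
have h1 := odd_neq_mul4 n k.
have -> : n.+2%:R = n%:R + 2 :> rat by rewrite -addn2 natrD.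
have -> : k.+1%:R = k%:R + 1 :> rat by rewrite -natr1.
field; do ! (apply/andP; split); try (apply: lt0r_neq0; lra).
all: by move: h1; apply: contra_neq; lra.
Qed.

Lemma term256_lin_sum_rec n :
  (2 * n%:R + 1) * (\sum_(0 <= k < n.+3) (6 * k%:R + 1) * term256 n.+2 k)
  = (2 * n%:R + 5) * (\sum_(0 <= k < n.+1) (6 * k%:R + 1) * term256 n k).
Proof.
have N0 : 0 <= n%:R :> rat by rewrite ler0n.
have -> : \sum_(0 <= k < n.+1) (6 * k%:R + 1) * term256 n k
        = \sum_(0 <= k < n.+3) (6 * k%:R + 1) * term256 n k.
  rewrite [RHS]big_nat_recr //= [in RHS]big_nat_recr //= (term256S n n.+1).
  by rewrite !term256_last mul0r !mulr0 !addr0.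
apply/eqP; rewrite -subr_eq0 !mulr_sumr -sumrB; apply/eqP.
pose g k := - (term256 n.+2 k * k%:R * (2 * n%:R + 5 + 4 * k%:R) * (2 * n%:R + 1)
  * (4 * k%:R - 2) / ((n%:R + 1 + k%:R) * (n%:R + 2 + k%:R))).
apply: (@telescope_eq0 _ _ g); last 2 first.
- by rewrite /g mulr0 !mul0r oppr0.
- by rewrite /g term256_last !mul0r oppr0.
move=> k kn; rewrite /g (term256_shift n k) term256S /ratio256.
have K0 : 0 <= k%:R :> rat by rewrite ler0n.
have h1 := odd_neq_mul4 n k.
have -> : n.+2%:R = n%:R + 2 :> rat by rewrite -addn2 natrD.
have -> : k.+1%:R = k%:R + 1 :> rat by rewrite -natr1.
field; do ! (apply/andP; split); try (apply: lt0r_neq0; lra).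
all: by move: h1; apply: contra_neq; lra.
Qed.

Lemma term16_sum n : \sum_(0 <= k < n.+1) term16 n k
  = (2 * n%:R + 1) * \prod_(0 <= j < n) ((3 * j%:R + 2) / (3 * j%:R + 4)).
Proof.
elim: n => [|n IH]; first by rewrite big_nat1 term16_0 big_geq.
(* The recurrence is available from parameter 1 on, so the value at 1 is computed directly. *)
case: n IH => [|n] IH.
  by rewrite !big_nat_recr //= !big_geq // term16_0 term16S term16_0 /ratio16; field.
rewrite [in RHS]big_nat_recr //=; have := term16_sum_rec n.+1 isT; rewrite IH.
have N0 : 0 <= n%:R :> rat by rewrite ler0n.
have -> : n.+2%:R = n%:R + 2 :> rat by rewrite -addn2 natrD.
have -> : n.+1%:R = n%:R + 1 :> rat by rewrite -natr1.
set P := \prod_(0 <= _ < _) _; set S := \sum_(0 <= _ < _) _ => E.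
have a0 : (2 * (n%:R + 1) + 1) * (3 * (n%:R + 1) + 4) != 0 :> rat.
  by apply: lt0r_neq0; rewrite mulr_gt0 //; lra.
apply: (mulfI a0); rewrite E; field; apply: lt0r_neq0; lra.
Qed.

Lemma term16_lin_sum n :
  \sum_(0 <= k < n.+1) (3 * k%:R + 1) * term16 n k = 2 * n%:R + 1.
Proof.
elim: n => [|n IH]; first by rewrite big_nat1 term16_0; ring.
case: n IH => [|n] IH.
  by rewrite !big_nat_recr //= !big_geq // term16_0 term16S term16_0 /ratio16; field.
have := term16_lin_sum_rec n.+1 isT; rewrite IH.
have N0 : 0 <= n%:R :> rat by rewrite ler0n.
have -> : n.+2%:R = n%:R + 2 :> rat by rewrite -addn2 natrD.
have -> : n.+1%:R = n%:R + 1 :> rat by rewrite -natr1.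
set S := \sum_(0 <= _ < _) _ => E.
have a0 : 2 * (n%:R + 1) + 1 != 0 :> rat by apply: lt0r_neq0; lra.
by apply: (mulfI a0); rewrite E; ring.
Qed.

Lemma nat_ind2 (P : nat -> Prop) :
  P 0%N -> P 1%N -> (forall n, P n -> P n.+2) -> forall n, P n.
Proof.
move=> P0 P1 PS n; suff [] : P n /\ P n.+1 by [].
by elim: n => [|n [IH1 IH2]]; split=> //; apply: PS.
Qed.

Lemma term256_sum n : \sum_(0 <= k < n.+1) term256 n k
  = (-1) ^+ n * (2 * n%:R + 1) * \prod_(0 <= j < uphalf n)
      ((6 * n%:R - 7 - 12 * j%:R) / (6 * n%:R + 1 - 12 * j%:R)).
Proof.
elim/nat_ind2: n => [||n IH].
- by rewrite big_nat1 term256_0 big_geq //; ring.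
- rewrite !big_nat_recr //= !big_geq // term256_0 term256S term256_0 /ratio256.
  by field.
(* Raising [n] by 2 adds 12 to [6n]: the new factor is the one at [j = 0], and the old ones move up
   by one index. *)
rewrite -[uphalf n.+2]/(uphalf n).+1 [in RHS]big_nat_recl //=.
have := term256_sum_rec n; rewrite IH.
have N0 : 0 <= n%:R :> rat by rewrite ler0n.
have -> : n.+2%:R = n%:R + 2 :> rat by rewrite -addn2 natrD.
have -> : \prod_(0 <= i < uphalf n)
    ((6 * (n%:R + 2) - 7 - 12 * i.+1%:R) / (6 * (n%:R + 2) + 1 - 12 * i.+1%:R))
  = \prod_(0 <= i < uphalf n)
    ((6 * n%:R - 7 - 12 * i%:R) / (6 * n%:R + 1 - 12 * i%:R)) :> rat.
  by apply: eq_bigr => i _; rewrite -natr1; congr (_ / _); ring.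
set P := \prod_(0 <= _ < _) _; set S := \sum_(0 <= _ < _) _ => E.
have a0 : (2 * n%:R + 1) * (6 * n%:R + 13) != 0 :> rat.
  by apply: lt0r_neq0; rewrite mulr_gt0 //; lra.
apply: (mulfI a0); rewrite E !exprS; field; apply: lt0r_neq0; lra.
Qed.

Lemma term256_lin_sum n :
  \sum_(0 <= k < n.+1) (6 * k%:R + 1) * term256 n k = (-1) ^+ n * (2 * n%:R + 1).
Proof.
elim/nat_ind2: n => [||n IH].
- by rewrite big_nat1 term256_0; ring.
- rewrite !big_nat_recr //= !big_geq // term256_0 term256S term256_0 /ratio256.
  by field.
have := term256_lin_sum_rec n; rewrite IH.
have N0 : 0 <= n%:R :> rat by rewrite ler0n.
have -> : n.+2%:R = n%:R + 2 :> rat by rewrite -addn2 natrD.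
set S := \sum_(0 <= _ < _) _ => E.
have a0 : 2 * n%:R + 1 != 0 :> rat by apply: lt0r_neq0; lra.
by apply: (mulfI a0); rewrite E !exprS; ring.
Qed.

(** * The quadratic relation *)

Lemma deriv_eq0 (F : numFieldType) (q : {poly F}) : q^`() = 0 -> q.[0] = 0 -> q = 0.
Proof.
move=> dq q0; apply/polyP => -[|i]; first by rewrite coef0 -horner_coef0.
move/polyP/(_ i): dq; rewrite coef_deriv !coef0 => /eqP.
by rewrite mulrn_eq0 /= => /eqP.
Qed.

Section FirstIntegral.
Variables (F : numFieldType) (n : nat) (l : F) (A : nat -> F).
Hypothesis A_rec : forall k, k.+1%:R ^+ 3 * A k.+1
  = 2 * (2 * k%:R + 1) * (l - k%:R * (k%:R + 1)) * A k.
Hypothesis A_last : forall k, (n < k)%N -> A k = 0.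

Let G := \poly_(k < n.+1) A k.
(** The antiderivative of [G] without constant term: at degree 0 the division by zero gives 0. *)
Let H := \poly_(k < n.+2) (A k.-1 / k%:R).

Let coefG k : G`_k = A k.
Proof. by rewrite coef_poly; case: ltnP => // /A_last ->. Qed.
Let coefH k : H`_k = A k.-1 / k%:R.
Proof.
rewrite coef_poly; case: ltnP => //; case: k => // k /A_last ->.
by rewrite mul0r.
Qed.

Let H_deriv : H^`() = G.
Proof.
apply/polyP => k; rewrite coef_deriv coefH coefG /= -[LHS]mulr_natr divfK //.
by rewrite pnatr_eq0.
Qed.

(** The recursion on [A] is a third-order differential equation for [G], the symmetric square of
    Legendre's equation. This is that equation integrated once, which is how [H] enters. *)
Let linear_relation : (2 * l) *: H - (4 * l) *: ('X * G)
  + ('X + 6 *: 'X^2) * G^`() + 'X^2 * (1 + 4 *: 'X) * G^`()^`() = 0.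
Proof.
have -> : (2 * l) *: H - (4 * l) *: ('X * G)
  + ('X + 6 *: 'X^2) * G^`() + 'X^2 * (1 + 4 *: 'X) * G^`()^`()
  = (2 * l) *: H - (4 * l) *: ('X * G) + 'X * G^`() + 6 *: ('X * ('X * G^`()))
    + 'X * ('X * G^`()^`()) + 4 *: ('X * ('X * ('X * G^`()^`()))).
  by rewrite -!mul_polyC expr2; ring.
apply/polyP => k; rewrite !coefD coefN !coefZ !coefXM !coef_deriv !coefG coefH coef0.
case: k => [|k] /=; first by rewrite invr0; ring.
case: k => [|k] /=.
  by have := A_rec 0; rewrite /= !mulr0 !add0r !mulr1n expr1n mul1r => ->; field.
set a := A k.+1; set b := A k.+2.
have -> : 4 * (if k == 0%N then 0 else A k.-1.+2 *+ k.-1.+2 *+ k.-1.+1)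
    = 4 * a * k%:R * (k%:R + 1).
  rewrite /a; case: (k) => [|j] /=; first by rewrite !mulr0 mul0r.
  by rewrite -mulrnA -(mulr_natr (A _)) natrM -!natr1; ring.
have := A_rec k.+1; rewrite -/a -/b => E.
have -> : b *+ k.+2 = b * (k%:R + 2) by rewrite -[LHS]mulr_natr -!natr1; ring.
have -> : a *+ k.+1 = a * (k%:R + 1) by rewrite -[LHS]mulr_natr -!natr1; ring.
have -> : b * (k%:R + 2) *+ k.+1 = b * (k%:R + 2) * (k%:R + 1).
  by rewrite -[LHS]mulr_natr -!natr1; ring.
have k2 : k%:R + 2 != 0 :> F by rewrite -natrD addn2 pnatr_eq0.
have k2E : k.+2%:R = k%:R + 2 :> F by rewrite -natrD addn2.
rewrite k2E -natr1 in E *.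
apply: (mulfI k2); rewrite mulr0.
have -> : (k%:R + 2) * (2 * l * (a / (k%:R + 2)) - 4 * l * a + b * (k%:R + 2)
    + 6 * (a * (k%:R + 1)) + b * (k%:R + 2) * (k%:R + 1) + 4 * a * k%:R * (k%:R + 1))
  = (k%:R + 2) ^+ 3 * b - 2 * (2 * k%:R + 3) * (l - (k%:R + 1) * (k%:R + 2)) * a.
  by field.
by rewrite E; ring.
Qed.

(** The derivative of the left side is [2 G'] times the linear relation, and its value at 0 is
    zero. *)
Let quadratic_relation :
  (4 * l) *: (H * G - 'X * G ^+ 2) + 'X^2 * (1 + 4 *: 'X) * G^`() ^+ 2 = 0.
Proof.
have H0 : H.[0] = 0 by rewrite horner_coef0 coefH invr0 mulr0.
apply: deriv_eq0.
  2: by rewrite hornerD hornerZ hornerD hornerN !hornerM ?hornerXn ?hornerX H0; ring.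
rewrite derivD derivZ derivB !derivM derivX derivD derivZ derivX !derivC add0r H_deriv.
have := congr1 (fun q => 2 * G^`() * q) linear_relation; rewrite mulr0 => <-.
rewrite -!mul_polyC !rmorphM !rmorph_nat /=; ring.
Qed.

(** The quadratic relation evaluated at [t]: the weights [1/(k+1)] come from [H(t) / t] and the
    weights [k] from [t G'(t)]. *)
Lemma clausen_first_integral (t : F) : t != 0 ->
  4 * l * (\sum_(0 <= k < n.+1) A k * t ^+ k / k.+1%:R)
     * (\sum_(0 <= k < n.+1) A k * t ^+ k)
  = 4 * l * (\sum_(0 <= k < n.+1) A k * t ^+ k) ^+ 2
    - (1 + 4 * t) / t * (\sum_(0 <= k < n.+1) k%:R * (A k * t ^+ k)) ^+ 2.
Proof.
move=> t0.
have HE : H.[t] = t * \sum_(0 <= k < n.+1) A k * t ^+ k / k.+1%:R.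
  rewrite horner_poly -(big_mkord xpredT (fun k => A k.-1 / k%:R * t ^+ k)).
  rewrite big_nat_recl //= invr0 mulr0 mul0r add0r mulr_sumr.
  by apply: eq_bigr => k _; rewrite exprS; ring.
have GE : G.[t] = \sum_(0 <= k < n.+1) A k * t ^+ k.
  by rewrite horner_poly big_mkord.
have dGE : t * G^`().[t] = \sum_(0 <= k < n.+1) k%:R * (A k * t ^+ k).
  rewrite -{1}(hornerX t) -hornerM.
  have -> : 'X * G^`() = \poly_(k < n.+1) (k%:R * A k).
    apply/polyP => -[|k]; rewrite coefXM coef_poly /= ?mul0r //.
    rewrite coef_deriv coefG; case: ltnP => [_|/A_last ->]; last by rewrite mul0rn.
    by rewrite mulr_natl.
  by rewrite horner_poly big_mkord; apply: eq_bigr => k _; rewrite mulrA.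
have := congr1 (horner^~ t) quadratic_relation.
rewrite hornerD hornerZ hornerD hornerN !hornerM ?horner_exp !hornerX GE HE.
rewrite hornerD hornerZ hornerX hornerC horner0 -dGE.
set S0 := \sum_(0 <= _ < _) A _ * _; set S := \sum_(0 <= _ < _) _ => E.
apply: (mulfI t0); apply/eqP; rewrite -subr_eq0 -[X in _ == X]E; apply/eqP.
by field.
Qed.
End FirstIntegral.

(** * Factorials, harmonic sums and Jacobi sums modulo the square of a prime *)

Lemma sum_even_odd (V : nmodType) (f : nat -> V) m :
  \sum_(0 <= j < 2 * m) f j = \sum_(0 <= i < m) (f (2 * i)%N + f (2 * i).+1).
Proof.
elim: m => [|m IH]; first by rewrite !big_geq.
have -> : (2 * m.+1 = (2 * m).+2)%N by lia.
by rewrite !big_nat_recr //= IH addrA.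
Qed.


(** The product of [xb - ya] and [-xb - ya] is [p(y^2 - b^2)], so [p] divides one of them. By the
    composition identity [E1] its square is at most [p^2 / 3], so that factor is zero. *)
Lemma norm_form_unique (p : nat) (x y a b : int) : prime p ->
  p%:Z = x ^+ 2 + 3 * y ^+ 2 -> p%:Z = a ^+ 2 + 3 * b ^+ 2 -> x ^+ 2 = a ^+ 2.
Proof.
move=> pp px pa.
have p0 : 0 < p%:Z :> int by rewrite ltz_nat prime_gt0.
have key (c : int) : p%:Z = a ^+ 2 + 3 * c ^+ 2 -> (p %| absz (x * c - y * a)%R)%N ->
    x ^+ 2 = a ^+ 2.
  move=> pc /dvdnP[q qE].
  have E1 : p%:Z ^+ 2 = (x * a + 3 * y * c) ^+ 2 + 3 * (x * c - y * a) ^+ 2.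
    by rewrite expr2 {1}px pc; ring.
  have E2 : (x * c - y * a) ^+ 2 = q%:Z ^+ 2 * p%:Z ^+ 2.
    by rewrite -[LHS]real_normK ?num_real // -abszE qE PoszM exprMn.
  have q0 : q = 0%N.
    have s0 : 0 <= (x * a + 3 * y * c) ^+ 2 := sqr_ge0 _.
    case: q E2 {qE} => // q E2; rewrite E2 in E1.
    have pp0 : 0 < p%:Z ^+ 2 by rewrite exprn_gt0.
    have : p%:Z ^+ 2 <= q.+1%:Z ^+ 2 * p%:Z ^+ 2 by apply: ler_peMl; [exact: ltW|exact: exprn_ege1].
    lia.
  have xc : x * c = y * a.
    by apply/eqP; rewrite -subr_eq0 -sqrf_eq0 E2 q0 mul0r.
  have cy : c ^+ 2 = y ^+ 2.
    apply: (mulfI (lt0r_neq0 p0)); rewrite {1}px pc.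
    transitivity ((x * c) ^+ 2 + 3 * y ^+ 2 * c ^+ 2); first by ring.
    by rewrite xc; ring.
  by apply: (addIr (3 * y ^+ 2)); rewrite -px pc cy.
have : (p %| absz ((x * b - y * a) * (x * - b - y * a))%R)%N.
  have -> : (x * b - y * a) * (x * - b - y * a) = p%:Z * (y ^+ 2 - b ^+ 2).
    transitivity (y ^+ 2 * (a ^+ 2 + 3 * b ^+ 2) - b ^+ 2 * (x ^+ 2 + 3 * y ^+ 2)); first by ring.
    by rewrite -px -pa; ring.
  by rewrite abszM dvdn_mulr.
rewrite abszM Euclid_dvdM // => /orP[]; first exact: key.
by apply: key; rewrite sqrrN.
Qed.

(** * Units and harmonic sums in a ring where [p^2 = 0] *)

Section ModPSquare.
Set Implicit Arguments. Unset Strict Implicit. Unset Printing Implicit Defensive.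
Variables (R : comUnitRingType) (h : nat).
Let p := (6 * h + 1)%N.
Hypothesis p_prime : prime p.
Let e : R := p%:R.
Hypothesis e2 : e * e = 0.
Hypothesis natU : forall m : nat, ~~ (p %| m)%N -> m%:R \is a @GRing.unit R.

Let h_gt0 : (0 < h)%N.
Proof. by have := p_prime; rewrite /p; case: (h). Qed.
Let p_gt6 : (6 < p)%N.
Proof. by rewrite /p; lia. Qed.
Let hE : h%:R * 6 = e - 1.
Proof. by rewrite /e /p natrD natrM; ring. Qed.

Lemma unit_small m : (0 < m < p)%N -> m%:R \is a @GRing.unit R.
Proof. by case/andP=> m0 mp; rewrite natU // gtnNdvd. Qed.

Lemma fact_unit m : (m < p)%N -> (m`!)%:R \is a @GRing.unit R.
Proof.
elim: m => [|m IH] mp; first by rewrite unitr1.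
by rewrite factS natrM unitrM unit_small // IH ?(ltnW mp).
Qed.

(** After multiplication by [e], a reciprocal depends only on its denominator modulo [p]. This lemma
    and the next replace [1/l] by [k/m] and [-k/m]. *)
Lemma einv_plus (k c l m : nat) : (k * l = c * p + m)%N ->
  (0 < l < p)%N -> (0 < m < p)%N -> e * l%:R^-1 = k%:R * (e * m%:R^-1).
Proof.
move=> E l1 m1; have lU := unit_small l1; have mU := unit_small m1.
apply: (mulIr lU); rewrite divrK //; apply: (mulIr mU).
transitivity (e * (k * l)%:R); first by rewrite E natrD natrM -/e mulrDr mulrCA e2; ring.
by transitivity (e * (k%:R * l%:R) * (m%:R / m%:R)); [rewrite divrr // mulr1 natrM|ring].
Qed.

Lemma einv_minus (k c l m : nat) : (k * l + m = c * p)%N ->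
  (0 < l < p)%N -> (0 < m < p)%N -> e * l%:R^-1 = - (k%:R * (e * m%:R^-1)).
Proof.
move=> E l1 m1; have lU := unit_small l1; have mU := unit_small m1.
apply: (mulIr lU); rewrite divrK //; apply: (mulIr mU).
transitivity (e * ((k * l + m)%:R - (k * l)%:R)); first by rewrite natrD; ring.
rewrite E !natrM -/e mulrBr mulrCA e2 mulr0 sub0r.
by transitivity (- (e * (k%:R * l%:R) * (m%:R / m%:R))); [rewrite divrr // mulr1|ring].
Qed.

Definition harm (m : nat) : R := \sum_(0 <= i < m) (i.+1%:R)^-1.
Lemma harmS m : harm m.+1 = harm m + (m.+1%:R)^-1.
Proof. by rewrite /harm big_nat_recr. Qed.
Lemma harm0 : harm 0 = 0. Proof. by rewrite /harm big_geq. Qed.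

(** Term by term, [1/(p - i) = -1/i] modulo [p]. The case [m = p - 1] then shows that the full sum
    vanishes, and the symmetry follows. *)
Lemma harm_reflect_aux m : (m < p)%N -> e * harm (6 * h - m) = e * harm (6 * h) + e * harm m.
Proof.
elim: m => [|m IH] mp; first by rewrite subn0 harm0; ring.
have := IH (ltnW mp); have -> : (6 * h - m = (6 * h - m.+1).+1)%N by rewrite /p in mp; lia.
rewrite !harmS !mulrDr (@einv_minus 1 1 _ m.+1) /p; [|lia|lia|lia].
rewrite mul1r => /(congr1 (fun x => x + e * m.+1%:R^-1)); rewrite subrK => ->; ring.
Qed.

Lemma harm_top : e * harm (6 * h) = 0.
Proof.
have := @harm_reflect_aux (6 * h); rewrite subnn harm0 mulr0 /p => /(_ ltac:(lia)) E.
have U2 : 2 \is a @GRing.unit R by apply: (@unit_small 2); lia.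
by apply: (mulrI U2); rewrite mulr0 E; ring.
Qed.

Lemma harm_reflect m : (m < p)%N -> e * harm (6 * h - m) = e * harm m.
Proof. by move=> mp; rewrite harm_reflect_aux // harm_top add0r. Qed.

(** * The subgroup [1 + pR] and factorials modulo [p^2] *)

Let U12 : 12 \is a @GRing.unit R.
Proof. by rewrite (natrM R 3 4) (natrM R 2 2) !unitrM !unit_small //; lia. Qed.
Let t : R := 12^-1.
Let t12 : 12 * t = 1. Proof. exact: divrr U12. Qed.

(* The subgroup 1 + pR of the units, in the normalisation that clears the
   denominators 2, 3, 4, 6, 12 in all exponents. *)
Definition punit (x : R) : R := 1 + e * (x * t).

Lemma punitD x y : punit (x + y) = punit x * punit y.
Proof.
rewrite /punit; have -> : (1 + e * (x * t)) * (1 + e * (y * t))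
  = 1 + e * ((x + y) * t) + (e * e) * (x * y * t * t) by ring.
by rewrite e2; ring.
Qed.
Lemma punit0 : punit 0 = 1. Proof. by rewrite /punit; ring. Qed.
Lemma punit_unit x : punit x \is a GRing.unit.
Proof. by apply/unitrPr; exists (punit (- x)); rewrite -punitD subrr punit0. Qed.
Lemma punitX x m : punit x ^+ m = punit (m%:R * x).
Proof.
elim: m => [|m IH]; first by rewrite mul0r punit0.
by rewrite exprS IH -punitD -natr1; congr punit; ring.
Qed.
Lemma punit_eq x y : e * x = e * y -> punit x = punit y.
Proof. by move=> exy; rewrite /punit !mulrA exy. Qed.
Lemma punit_inj x y : punit x = punit y -> e * x = e * y.
Proof.
rewrite /punit => /addrI; rewrite !mulrA => /(congr1 (fun z => z * 12)).
by rewrite -!mulrA [t * _]mulrC t12 !mulr1.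
Qed.

(** Each factor is [c e + d l = d l (1 + (c/d) e / l)], and the hypothesis writes [c/d] as [c'/12],
    the normalisation of [punit]. *)
Lemma prod_shift (c d c' : R) (a b : nat) : 12 * c = d * c' -> (a <= b < p)%N ->
  (\prod_(a <= l < b) (c * e + d * l.+1%:R)) * (a`!)%:R
  = d ^+ (b - a) * (b`!)%:R * punit (c' * (harm b - harm a)).
Proof.
move=> cd /andP[ab]; move: ab; elim: b => [|b IH].
  by rewrite leqn0 => /eqP -> _; rewrite big_geq // subrr mulr0 punit0; ring.
rewrite leq_eqVlt => /orP[/eqP <- _|ab bp].
  by rewrite big_geq // subnn subrr mulr0 punit0; ring.
rewrite big_nat_recr //= mulrAC IH ?(ltnW bp) // subSn // harmS factS natrM.
have -> : c' * (harm b + b.+1%:R^-1 - harm a) = c' * (harm b - harm a) + c' * b.+1%:R^-1.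
  by ring.
rewrite punitD exprS.
have bU : b.+1%:R * b.+1%:R^-1 = 1 :> R by rewrite divrr ?unit_small.
set H := c' * (_ - _).
suff F : punit H * (c * e + d * b.+1%:R) = d * b.+1%:R * (punit H * punit (c' * b.+1%:R^-1)).
  by rewrite -!mulrA F; ring.
have -> : c = d * c' * t by rewrite -cd mulrAC t12 mul1r.
rewrite {3}/punit; set i := _^-1 in bU *.
have -> : d * b.+1%:R * (punit H * (1 + e * (c' * i * t)))
  = punit H * (d * b.+1%:R + d * c' * t * e * (b.+1%:R * i)) by ring.
by rewrite bU; ring.
Qed.

(** A duplication formula: the odd factor [2m + 1] is [p - 2(3h - m)], that is [-2(3h - m)] times an
    element of [1 + pR]. The factor [1 - p/(2(3h - m))] accounts for the exponent [-6 = -12/2]. *)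
Lemma fact_dup m : (m <= 3 * h)%N ->
  ((2 * m)`!)%:R * ((3 * h - m)`!)%:R
  = (-4) ^+ m * (m`!)%:R * ((3 * h)`!)%:R * punit (- 6 * (harm (3 * h) - harm (3 * h - m))) :> R.
Proof.
elim: m => [|m IH] mh.
  by rewrite subn0 subrr mulr0 punit0 muln0; ring.
have kE : (3 * h - m = (3 * h - m.+1).+1)%N by lia.
have := IH (ltnW mh); rewrite kE.
have -> : (2 * m.+1 = (2 * m).+2)%N by lia.
set k := (3 * h - m.+1)%N; rewrite harmS (factS k) (factS m).
have kU : k.+1%:R \is a @GRing.unit R by rewrite unit_small // /k /p; lia.
have kV : k.+1%:R * k.+1%:R^-1 = 1 :> R by rewrite divrr.
move=> F; apply: (mulrI kU).
rewrite (factS (2 * m).+1) (factS (2 * m)) !natrM exprS.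
have -> : - 6 * (harm (3 * h) - harm k) =
   - 6 * (harm (3 * h) - (harm k + k.+1%:R^-1)) + (- 6 * k.+1%:R^-1) by ring.
rewrite punitD; move: F; rewrite natrM; set X := punit _ => F.
transitivity (((2 * m).+2)%:R * ((2 * m).+1)%:R * (((2 * m)`!)%:R * (k.+1%:R * (k`!)%:R)) : R).
  by ring.
rewrite F /punit; set i := _^-1 in kV *.
have e6 : (2 * m).+1%:R = e - 2 * k.+1%:R :> R.
  have <- : ((2 * m).+1 + 2 * k.+1)%:R = e by rewrite /e; congr _%:R; rewrite /k /p; lia.
  by rewrite natrD natrM; ring.
have -> : (2 * m).+2%:R = 2 * m.+1%:R :> R by rewrite -natrM; congr _%:R; lia.
rewrite e6.
have -> : k.+1%:R * (-4 * (-4) ^+ m * (m.+1%:R * m`!%:R) * (3 * h)`!%:R * (X * (1 + e * (-6 * i * t))))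
  = (-4) ^+ m * (m.+1%:R * m`!%:R) * (3 * h)`!%:R * X *
     (-4 * k.+1%:R + 2 * e * (12 * t) * (k.+1%:R * i)) by ring.
by rewrite kV t12; ring.
Qed.

(** The top [m] factors of [(p-1)!] are [p - i = -i(1 - p/i)]. *)
Lemma fact_reflect m : (m < p)%N ->
  ((6 * h - m)`!)%:R * (m`!)%:R * (-1) ^+ m * punit (- 12 * harm m) = ((6 * h)`!)%:R :> R.
Proof.
elim: m => [|m IH] mp; first by rewrite subn0 harm0 mulr0 punit0 fact0 expr0; ring.
rewrite -IH ?(ltnW mp) //.
have -> : (6 * h - m = (6 * h - m.+1).+1)%N by rewrite /p in mp; lia.
set k := (6 * h - m.+1)%N.
rewrite harmS (factS k) (factS m) !natrM (mulrDr (- 12)) punitD exprS.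
have mV : m.+1%:R * m.+1%:R^-1 = 1 :> R by rewrite divrr // unit_small.
have -> : k.+1%:R = e - m.+1%:R :> R.
  by rewrite /e -natrB; [congr _%:R|]; rewrite /k /p; rewrite /p in mp; lia.
rewrite {2}/punit; set i := _^-1 in mV *; set X := punit _.
have -> : k`!%:R * (m.+1%:R * m`!%:R) * (-1 * (-1) ^+ m) * (X * (1 + e * (-12 * i * t)))
  = k`!%:R * m`!%:R * (-1) ^+ m * X * (- m.+1%:R + (12 * t) * e * (m.+1%:R * i)) by ring.
by rewrite mV t12; ring.
Qed.

(** Duplication and reflection at [m = 3h] both evaluate [(6h)!]. The outcome is the classical
    harmonic sum for the Fermat quotient of 2. *)
Lemma pow2_top : 2 ^+ (6 * h) = punit (- 6 * harm (3 * h)).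
Proof.
have F1 := @fact_dup (3 * h) (leqnn _).
have := @fact_reflect (3 * h); rewrite /p => /(_ ltac:(lia)).
have -> : (6 * h - 3 * h = 3 * h)%N by lia.
move: F1; rewrite subnn harm0 subr0.
have -> : (2 * (3 * h) = 6 * h)%N by lia.
rewrite mulr1 => -> F2.
have fU : (3 * h)`!%:R \is a @GRing.unit R by rewrite fact_unit // /p; lia.
have sU : (-1) ^+ (3 * h) \is a @GRing.unit R by rewrite unitrX ?unitrN1.
apply: (mulrI fU); apply: (mulrI fU); apply: (mulrI sU); apply: (mulIr (punit_unit (-6 * harm (3 * h)))).
have -> : (2 : R) ^+ (6 * h) = 4 ^+ (3 * h).
  have -> : (6 * h = 2 * (3 * h))%N by lia.
  by rewrite exprM; congr (_ ^+ _); ring.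
have EE : punit (- 6 * harm (3 * h)) * punit (- 6 * harm (3 * h)) = punit (- 12 * harm (3 * h)).
  by rewrite -punitD; congr punit; ring.
transitivity ((-4) ^+ (3 * h) * (3 * h)`!%:R * (3 * h)`!%:R * punit (- 6 * harm (3 * h))).
  by rewrite -[-4]mulN1r exprMn; ring.
by rewrite -F2 -EE; ring.
Qed.

Lemma harm_tail a b : (a <= b)%N -> harm b - harm a = \sum_(0 <= i < b - a) ((a + i).+1%:R)^-1.
Proof.
move=> ab; rewrite /harm (big_cat_nat (leq0n a) ab) //= addrAC subrr add0r.
by rewrite -{1}[a]add0n big_addn; apply: eq_bigr => i _; rewrite addnC.
Qed.

(** Multiplying denominators by 6 or 3 and removing multiples of [p] turns each block of reciprocals
    into sums [S c] over a residue class modulo 6; the relation follows by elimination. *)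
Lemma harm_sixths : e * harm (3 * h) = e * (harm h - harm (2 * h)).
Proof.
pose S c := \sum_(0 <= i < h) e * ((6 * i + c)%N%:R)^-1 : R.
have h1 : e * harm h = - 6 * S 1%N.
  rewrite /harm big_nat_rev /= !mulr_sumr; apply: eq_big_nat => i /andP[_ ih].
  by rewrite (@einv_minus 6 1 _ (6 * i + 1)) /p; [ring|lia|lia|lia].
have h2 : e * (harm (2 * h) - harm h) = 6 * S 5%N.
  rewrite harm_tail; last by lia.
  have -> : (2 * h - h = h)%N by lia.
  rewrite !mulr_sumr; apply: eq_big_nat => i /andP[_ ih].
  by rewrite (@einv_plus 6 1 _ (6 * i + 5)) /p; [ring|lia|lia|lia].
have h3 : e * (harm (3 * h) - harm (2 * h)) = - 6 * S 3%N.
  rewrite harm_tail; last by lia.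
  have -> : (3 * h - 2 * h = h)%N by lia.
  rewrite big_nat_rev /= !mulr_sumr; apply: eq_big_nat => i /andP[_ ih].
  by rewrite (@einv_minus 6 3 _ (6 * i + 3)) /p; [ring|lia|lia|lia].
have h4 : e * harm (2 * h) = - 3 * S 1%N + 3 * S 3%N.
  rewrite /harm big_nat_rev sum_even_odd /= mulr_sumr.
  transitivity (\sum_(0 <= i < h) (- 3 * (e * ((6 * i + 1)%N%:R)^-1)
      + 3 * (e * ((6 * (0 + h - i.+1) + 3)%N%:R)^-1))).
    apply: eq_big_nat => i /andP[_ ih]; rewrite mulrDr.
    rewrite (@einv_minus 3 1 _ (6 * i + 1)) /p; [|lia|lia|lia].
    rewrite (@einv_plus 3 0 (0 + 2 * h - (2 * i).+2).+1 (6 * (0 + h - i.+1) + 3)) /p; [by rewrite mulNr|lia|lia|lia].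
  rewrite big_split /=; congr (_ + _); rewrite -mulr_sumr /S //.
  by congr (_ * _); rewrite [RHS]big_nat_rev.
move: h2 h3; rewrite !mulrBr h4 => h2 /eqP; rewrite subr_eq => /eqP ->.
rewrite -[RHS]opprB h2 -h2 h1; ring.
Qed.

(** Modulo [p] this is twice the Fermat quotient of 2, by [pow2_D]. *)
Let D : R := harm (2 * h) - harm h.

Lemma pow2_D : 2 ^+ (6 * h) = punit (6 * D).
Proof.
rewrite pow2_top; apply: punit_eq.
by rewrite mulrCA harm_sixths /D; ring.
Qed.

Lemma pow4_D : 4 ^+ (8 * h * p + h) = punit (2 * D).
Proof.
(* Indeed [2(8hp + h) = 6h(16h + 3)]; afterwards [6h = -1] modulo [p] reduces [6(16h + 3)] to 2. *)
have -> : (4 : R) ^+ (8 * h * p + h) = (2 ^+ (6 * h)) ^+ (16 * h + 3).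
  rewrite -exprM; have -> : (4 : R) = 2 ^+ 2 by ring.
  by rewrite -exprM; congr (_ ^+ _); rewrite /p; lia.
rewrite pow2_D punitX; apply: punit_eq.
rewrite natrD natrM.
have -> : e * ((16 * h%:R + 3) * (6 * D)) = e * ((16 * (h%:R * 6) + 18) * D) by ring.
by rewrite hE; transitivity (e * (2 * D) + 16 * (e * e) * D); [ring|rewrite e2; ring].
Qed.

(** * The closed form for 16 in terms of a central binomial coefficient *)

Definition jac : R := ('C(4 * h, 2 * h))%:R.

Lemma jacE : jac * (2 * h)`!%:R * (2 * h)`!%:R = (4 * h)`!%:R.
Proof.
rewrite /jac -mulrA -!natrM; congr _%:R.
by rewrite -(@bin_fact (4 * h) (2 * h)); [congr (_ * (_ * _`!))%N; lia|lia].
Qed.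

Lemma harm_4h : e * harm (4 * h) = e * harm (2 * h).
Proof.
rewrite -(@harm_reflect (2 * h)); last by rewrite /p; lia.
by congr (e * harm _); lia.
Qed.

Lemma fact_4h : (4 * h)`!%:R * h`!%:R
  = 4 ^+ (2 * h) * (2 * h)`!%:R * (3 * h)`!%:R * punit (- 6 * (harm (3 * h) - harm h)) :> R.
Proof.
have := @fact_dup (2 * h) ltac:(lia).
have -> : (2 * (2 * h) = 4 * h)%N by lia.
have -> : (3 * h - 2 * h = h)%N by lia.
by move=> ->; rewrite -[-4]mulN1r exprMn [(-1) ^+ _]exprM sqrrN expr1n expr1n mul1r.
Qed.

Lemma fact_2h : (2 * h)`!%:R * (2 * h)`!%:R
  = (-4) ^+ h * h`!%:R * (3 * h)`!%:R * punit (- 6 * (harm (3 * h) - harm (2 * h))) :> R.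
Proof.
have := @fact_dup h ltac:(lia).
by have -> : (3 * h - h = 2 * h)%N by lia.
Qed.

(** [T] will be the sum of the [term16 n k], known through its closed form after a factor [p] has
    cancelled. The three products become factorials by [prod_shift], and the powers of 3 cancel. *)
Lemma eval16 (T : R) :
  T * (\prod_(0 <= l < 2 * h) (1 * e + - 3 * l.+1%:R) * \prod_(0 <= l < h) (1 * e + 3 * l.+1%:R))
    = \prod_(h <= l < 4 * h) (2 * e + - 3 * l.+1%:R) ->
  T * (2 * h)`!%:R * h`!%:R * h`!%:R * punit (- 4 * D) = (-1) ^+ h * (4 * h)`!%:R * punit (- 8 * D).
Proof.
have hp : (h <= 4 * h < p)%N by rewrite /p; lia.
have h2p : (0 <= 2 * h < p)%N by rewrite /p; lia.
have h1p : (0 <= h < p)%N by rewrite /p; lia.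
have P1 := @prod_shift 1 (- 3) (- 4) _ _ ltac:(ring) h2p.
have P2 := @prod_shift 1 3 4 _ _ ltac:(ring) h1p.
have P3 := @prod_shift 2 (- 3) (- 8) _ _ ltac:(ring) hp.
move: P1 P2 P3; rewrite !fact0 !mulr1 harm0 !subr0 => -> -> P3 TE.
have U3 : 3 \is a @GRing.unit R by rewrite (unit_small (m := 3)); lia.
have U33 : 3 ^+ (3 * h) \is a @GRing.unit R by rewrite unitrX.
apply: (mulrI U33).
have <- : punit (- 4 * harm (2 * h)) * punit (4 * harm h) = punit (- 4 * D).
  by rewrite -punitD /D; congr punit; ring.
have <- : punit (- 8 * (harm (4 * h) - harm h)) = punit (- 8 * D).
  apply: punit_eq; rewrite /D; transitivity (- 8 * (e * harm (4 * h)) + 8 * (e * harm h)); first by ring.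
  by rewrite harm_4h; ring.
transitivity (T * ((- 3) ^+ (2 * h) * (2 * h)`!%:R * punit (- 4 * harm (2 * h))
   * (3 ^+ h * h`!%:R * punit (4 * harm h))) * h`!%:R).
  have -> : (- 3 : R) ^+ (2 * h) = 3 ^+ (2 * h) by rewrite exprM sqrrN -exprM.
  have -> : (3 * h = 2 * h + h)%N by lia.
  by rewrite exprD; ring.
rewrite !subn0 in TE; rewrite TE P3.
have -> : (4 * h - h = 3 * h)%N by lia.
have -> : (- 3 : R) ^+ (3 * h) = (-1) ^+ h * 3 ^+ (3 * h).
  rewrite -[-3]mulN1r exprMn; congr (_ * _); have -> : (3 * h = h + 2 * h)%N by lia.
  by rewrite exprD exprM sqrrN !expr1n mulr1.
by ring.
Qed.

(** Duplication at [h] and [2h] removes [(3h)!], and [pow4_D] absorbs what is left in [1 + pR]. The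
    power of 4 is the one that occurs in the square of [ksum (4 * h)]. *)
Lemma eval16_jac (T : R) :
  T * (2 * h)`!%:R * h`!%:R * h`!%:R * punit (- 4 * D) = (-1) ^+ h * (4 * h)`!%:R * punit (- 8 * D) ->
  T = 4 ^+ (8 * h * p) * jac ^+ 2.
Proof.
move=> TE.
have F1 : h`!%:R \is a @GRing.unit R by rewrite fact_unit // /p; lia.
have F2 : (2 * h)`!%:R \is a @GRing.unit R by rewrite fact_unit // /p; lia.
have U4 : 4 ^+ h \is a @GRing.unit R by rewrite unitrX // (unit_small (m := 4)); lia.
have := fact_4h; have := fact_2h; have := jacE; move: TE F1 F2.
set f1 := h`!%:R; set f2 := (2 * h)`!%:R; set f4 := (4 * h)`!%:R; set f3 := (3 * h)`!%:R.
move=> TE F1 F2 jE f22 f41.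
apply: (mulIr F2); apply: (mulIr F2); apply: (mulIr F2); apply: (mulIr F2).
apply: (mulIr F1); apply: (mulIr F1); apply: (mulIr (punit_unit (- 4 * D))); apply: (mulIr U4).
transitivity ((T * f2 * f1 * f1 * punit (- 4 * D)) * (f2 * f2) * f2 * 4 ^+ h); first by ring.
rewrite TE f22.
transitivity (4 ^+ (8 * h * p) * (jac * f2 * f2) * (jac * f2 * f2) * f1 * f1 * punit (- 4 * D) * 4 ^+ h);
  last by ring.
rewrite jE.
transitivity (4 ^+ (8 * h * p + h) * f4 * (f4 * f1) * f1 * punit (- 4 * D));
  last by rewrite exprD; ring.
rewrite pow4_D f41.
have -> : (-4 : R) ^+ h = (-1) ^+ h * 4 ^+ h by rewrite -exprMn mulN1r.
have -> : (4 : R) ^+ (2 * h) = 4 ^+ h * 4 ^+ h by rewrite -exprD; congr (_ ^+ _); lia.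
have s2 : (-1) ^+ h * (-1) ^+ h = 1 :> R by rewrite -expr2 sqrr_sign.
set E1 := punit _; set E2 := punit _; set E3 := punit _; set E4 := punit _; set E5 := punit _.
have EE : E1 * E2 = E3 * E4 * E5.
  by rewrite /E1 /E2 /E3 /E4 /E5 -!punitD /D; congr punit; ring.
transitivity ((-1) ^+ h * (-1) ^+ h * f4 * f2 * f1 * f3 * 4 ^+ h * 4 ^+ h * (E1 * E2)); first by ring.
by rewrite s2 EE; ring.
Qed.

(** * The closed form for 256, by parity of [h] *)

Lemma harm_dup m : (m <= 3 * h)%N ->
  e * (2 * harm (2 * m)) = e * (harm m - harm (3 * h) + harm (3 * h - m)).
Proof.
elim: m => [|m IH] mh; first by rewrite muln0 subn0 harm0; ring.
have := IH (ltnW mh); have -> : (3 * h - m = (3 * h - m.+1).+1)%N by lia.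
have -> : (2 * m.+1 = (2 * m).+2)%N by lia.
have := @einv_plus 2 0 m.+1 (2 * m).+2; have := @einv_minus 2 1 (3 * h - m.+1).+1 (2 * m).+1.
rewrite /p => /(_ ltac:(lia) ltac:(lia) ltac:(lia)) i2 /(_ ltac:(lia) ltac:(lia) ltac:(lia)) i1.
set k := (3 * h - m.+1)%N in i2 *.
rewrite (harmS k) (harmS (2 * m).+1) (harmS (2 * m)) (harmS m) => F.
transitivity (e * (2 * harm (2 * m)) + 2 * (e * (2 * m).+1%:R^-1) + 2 * (e * (2 * m).+2%:R^-1)).
  by ring.
transitivity (e * (harm m - harm (3 * h) + (harm k + k.+1%:R^-1)) - e * k.+1%:R^-1
  + e * m.+1%:R^-1); last by ring.
by rewrite F i1 i2; ring.
Qed.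

Lemma sign_mul_pow12 m : (- 12 : R) ^+ (m.+1 + h) = - 12 * (- 12) ^+ m * ((-1) ^+ h * 12 ^+ h).
Proof. by rewrite exprD exprS -exprMn mulN1r. Qed.

(** The analogue of [eval16] for [term256]. Removing [p] from the denominator leaves [h + m] factors
    there against [m + 1 + h] above, whence the surplus [-12]. *)
Lemma eval256 (T : R) (m : nat) : (m.+1 + h <= 2 * h)%N ->
  T * (\prod_(0 <= l < h) (1 * e + 12 * l.+1%:R) * \prod_(0 <= l < m) (1 * e + - 12 * l.+1%:R))
    = (-1) ^+ h * \prod_(h <= l < h + (m.+1 + h)) (5 * e + - 12 * l.+1%:R) ->
  T * h`!%:R * h`!%:R * m`!%:R * punit (harm h - harm m)
   = - 12 * (h + (m.+1 + h))`!%:R * punit (- 5 * (harm (h + (m.+1 + h)) - harm h)).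
Proof.
move=> mh.
have hp : (h <= h + (m.+1 + h) < p)%N by rewrite /p; lia.
have h2p : (0 <= h < p)%N by rewrite /p; lia.
have h1p : (0 <= m < p)%N by rewrite /p; lia.
have P1 := @prod_shift 1 12 1 _ _ ltac:(ring) h2p.
have P2 := @prod_shift 1 (- 12) (- 1) _ _ ltac:(ring) h1p.
have P3 := @prod_shift 5 (- 12) (- 5) _ _ ltac:(ring) hp.
move: P1 P2 P3; rewrite !fact0 !mulr1 harm0 !subr0 !subn0 => -> -> P3 TE.
have U1 : 12 ^+ h * (- 12) ^+ m \is a @GRing.unit R.
  by rewrite unitrM !unitrX // unitrN.
apply: (mulrI U1).
have <- : punit (1 * harm h) * punit (- 1 * harm m) = punit (harm h - harm m).
  by rewrite -punitD; congr punit; ring.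
transitivity (T * (12 ^+ h * h`!%:R * punit (1 * harm h) * ((-12) ^+ m * m`!%:R * punit (-1 * harm m))) * h`!%:R).
  by ring.
rewrite TE -[LHS]mulrA P3.
have -> : (h + (m.+1 + h) - h = m.+1 + h)%N by lia.
rewrite sign_mul_pow12.
have s2 : (-1) ^+ h * (-1) ^+ h = 1 :> R by rewrite -expr2 sqrr_sign.
set X := punit _; set F := _`!%:R.
transitivity ((-1) ^+ h * (-1) ^+ h * (12 ^+ h * (-12) ^+ m * (-12 * F * X))); first by ring.
by rewrite s2 mul1r.
Qed.

(** Since 2 is invertible, squaring is injective on [1 + pR]; knowing [w] modulo [p], namely [c],
    settles the sign. *)
Lemma punit_sqrt (w c z : R) : w = c * punit z -> c \is a GRing.unit -> w ^+ 2 = c ^+ 2 * punit (6 * D) ->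
  w = c * punit (3 * D).
Proof.
move=> -> cU; rewrite exprMn punitX => /(mulrI (unitrX 2 cU)) /punit_inj E2; congr (_ * _).
have U2 : 2 \is a @GRing.unit R by rewrite (unit_small (m := 2)); lia.
apply: punit_eq; apply: (mulrI U2); transitivity (e * (2 * z)); first by ring.
by rewrite E2; ring.
Qed.

(** In the duplication formula at [m = 3g] one has [2m = 3h] and [3h - m = m], so all factorials
    cancel and the power lies in [1 + pR]. Its square is [2^(6h)]. *)
Lemma pow4_even g : h = (2 * g)%N -> (-4) ^+ (3 * g) = punit (3 * D).
Proof.
move=> hg; rewrite -[RHS]mul1r.
apply: (@punit_sqrt _ 1 (6 * (harm (3 * h) - harm (3 * g)))); rewrite ?unitr1 //.
- rewrite mul1r; have := @fact_dup (3 * g) ltac:(lia).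
  have -> : (2 * (3 * g) = 3 * h)%N by lia.
  have -> : (3 * h - 3 * g = 3 * g)%N by lia.
  have U3 : (3 * h)`!%:R \is a @GRing.unit R by rewrite fact_unit // /p; lia.
  have Ug : (3 * g)`!%:R \is a @GRing.unit R by rewrite fact_unit // /p; lia.
  set z := harm _ - _ => F; apply: (mulrI U3); apply: (mulrI Ug); apply: (mulIr (punit_unit (- 6 * z))).
  transitivity ((3 * h)`!%:R * (3 * g)`!%:R : R); first by rewrite F; ring.
  transitivity ((3 * h)`!%:R * (3 * g)`!%:R * (punit (6 * z) * punit (- 6 * z))); last by ring.
  by rewrite -punitD -mulrDl subrr mul0r punit0 mulr1.
rewrite expr1n mul1r -exprM -pow2_D.
have -> : (3 * g * 2 = 2 * (3 * g))%N by lia.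
rewrite exprM sqrrN; have -> : (4 : R) ^+ 2 = 2 ^+ 4 by ring.
by rewrite -exprM; congr (_ ^+ _); lia.
Qed.

(** Duplication at [m = 3g + 2] leaves the quotient of [3h + 1] by [3g + 2], which is 2 because
    [2(3h + 1)] and [4(3g + 2)] both equal [p + 1]. *)
Lemma pow4_odd g : h = (2 * g).+1 -> (-4) ^+ (3 * g + 2) = 2 * punit (3 * D).
Proof.
move=> hg; have U2 : 2 \is a @GRing.unit R by rewrite (unit_small (m := 2)); lia.
apply: (@punit_sqrt _ 2 (6 * (harm (3 * h) - harm (3 * g + 1)))) => //.
- have := @fact_dup (3 * g + 2) ltac:(lia).
  have -> : (2 * (3 * g + 2) = (3 * h).+1)%N by lia.
  have -> : (3 * h - (3 * g + 2) = 3 * g + 1)%N by lia.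
  have -> : ((3 * g + 2) = (3 * g + 1).+1)%N by lia.
  rewrite (factS (3 * h)) (factS (3 * g + 1)) !natrM.
  have U3 : (3 * h)`!%:R \is a @GRing.unit R by rewrite fact_unit // /p; lia.
  have Ug : (3 * g + 1)`!%:R \is a @GRing.unit R by rewrite fact_unit // /p; lia.
  have Up : (e + 1) \is a @GRing.unit R.
    by rewrite /e natr1 natU // -addn1 dvdn_addr // gtnNdvd // /p; lia.
  have h1 : 2 * (3 * h).+1%:R = e + 1 :> R.
    by rewrite /e natr1 -natrM; congr _%:R; rewrite /p; lia.
  have g1 : 4 * (3 * g + 1).+1%:R = e + 1 :> R.
    by rewrite /e natr1 -natrM; congr _%:R; rewrite /p; lia.
  set z := harm _ - _ => F; apply: (mulrI U3); apply: (mulrI Ug); apply: (mulIr (punit_unit (- 6 * z))).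
  apply: (mulrI Up); rewrite -{1}g1.
  transitivity (4 * ((-4) ^+ (3 * g + 1).+1 * ((3 * g + 1).+1%:R * (3 * g + 1)`!%:R) * (3 * h)`!%:R
    * punit (- 6 * z))); first by ring.
  rewrite -F -h1.
  transitivity (4 * (3 * h).+1%:R * (3 * h)`!%:R * (3 * g + 1)`!%:R * (punit (6 * z) * punit (- 6 * z))); last by ring.
  by rewrite -punitD -mulrDl subrr mul0r punit0; ring.
rewrite -exprM -pow2_D.
have -> : ((3 * g + 2) * 2 = 2 * (3 * g + 2))%N by lia.
rewrite exprM sqrrN; have -> : (4 : R) ^+ 2 = 2 ^+ 4 by ring.
by rewrite -exprM -exprD; congr (_ ^+ _); lia.
Qed.

Lemma fact_5h : (5 * h)`!%:R * h`!%:R * (-1) ^+ h * punit (- 12 * harm h)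
  = (4 * h)`!%:R * (2 * h)`!%:R * punit (- 12 * harm (2 * h)) :> R.
Proof.
have := @fact_reflect h ltac:(rewrite /p; lia); have := @fact_reflect (2 * h) ltac:(rewrite /p; lia).
have -> : (6 * h - h = 5 * h)%N by lia.
have -> : (6 * h - 2 * h = 4 * h)%N by lia.
by rewrite exprM sqrrN !expr1n mulr1 => -> ->.
Qed.

Lemma harm_5h : e * harm (5 * h) = e * harm h.
Proof.
rewrite -(@harm_reflect h); last by rewrite /p; lia.
by congr (e * harm _); lia.
Qed.

(** Duplication at [5(g + 1)] brings in [(5h)!], which reflection expresses through [h!], [(2h)!]
    and [(4h)!]. The constant is absorbed by [-12(g + 1) = -6h = 1 - p]. *)
Lemma fact256_even g : h = (2 * g.+1)%N ->
  (4 * h)`!%:R * g`!%:R = - 12 * (5 * g.+1)`!%:R * (2 * h)`!%:R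
    * punit (- 5 * harm (5 * g.+1) + 4 * harm h + harm g + 4 * D) :> R.
Proof.
move=> hg; have := @fact_dup (5 * g.+1) ltac:(lia).
have := @harm_dup (5 * g.+1) ltac:(lia).
have -> : (2 * (5 * g.+1) = 5 * h)%N by lia.
have -> : (3 * h - 5 * g.+1 = g.+1)%N by lia.
rewrite [e * (2 * _)]mulrCA harm_5h => HN.
have {}HN : e * harm (5 * g.+1) = e * (3 * harm h - harm (2 * h) - harm g.+1).
  transitivity (e * (harm (5 * g.+1) - harm (3 * h) + harm g.+1) + e * harm (3 * h) - e * harm g.+1).
    by ring.
  by rewrite -HN harm_sixths; ring.
have gE : e * g.+1%:R^-1 = - 12 * e.
  rewrite (@einv_minus 12 1 g.+1 1) /p; [|lia|lia|lia].
  by rewrite invr1; ring.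
have g12 : - 12 * g.+1%:R = punit (- 12).
  rewrite /punit; have -> : - 12 * g.+1%:R = - (h%:R * 6) :> R by rewrite hg natrM; ring.
  by rewrite hE mulNr t12; ring.
have hsign : (-1) ^+ h = 1 :> R by rewrite hg exprM sqrrN !expr1n.
have F1 : h`!%:R \is a @GRing.unit R by rewrite fact_unit // /p; lia.
have F3 : (3 * h)`!%:R \is a @GRing.unit R by rewrite fact_unit // /p; lia.
have Gu : g.+1%:R \is a @GRing.unit R by rewrite unit_small // /p; lia.
have U4 : (-4) ^+ (5 * g.+1) \is a @GRing.unit R.
  by rewrite unitrX // unitrN (unit_small (m := 4)); lia.
have N4 : (-4) ^+ (5 * g.+1) = (-4) ^+ h * punit (3 * D).
  by rewrite -(pow4_even hg) -exprD; congr (_ ^+ _); lia.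
have := fact_2h; have := fact_5h; rewrite hsign mulr1.
set f1 := h`!%:R in F1 *; set f2 := (2 * h)`!%:R; set f4 := (4 * h)`!%:R.
set f3 := (3 * h)`!%:R in F3 *; set f5 := (5 * h)`!%:R; set fN := (5 * g.+1)`!%:R.
rewrite factS natrM; set fg := g`!%:R.
set X := - 5 * _ + _ + _ + _; set Y := - 6 * (_ - harm g.+1).
move=> f51 f22 fND.
apply: (mulrI Gu); apply: (mulrI U4); apply: (mulrI F3); apply: (mulrI F1).
apply: (mulIr (punit_unit Y)); apply: (mulIr (punit_unit (- 12 * harm h))).
transitivity (- 12 * g.+1%:R * f2 * f1 * punit X * punit (- 12 * harm h)
  * ((-4) ^+ (5 * g.+1) * fN * f3 * punit Y)); last by ring.
rewrite -fND g12.
transitivity (punit (- 12) * punit X * f2 * (g.+1%:R * fg) * (f5 * f1 * punit (- 12 * harm h))); last by ring.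
rewrite f51.
transitivity (punit (- 12) * punit X * punit (- 12 * harm (2 * h)) * (g.+1%:R * fg) * f4 * (f2 * f2)); last by ring.
rewrite f22 N4; set Z := - 6 * _.
have EE : punit (- 12) * punit X * punit (- 12 * harm (2 * h)) * punit Z = punit (3 * D) * punit Y * punit (- 12 * harm h).
  rewrite -!punitD; apply: punit_eq; rewrite /X /Y /Z /D.
  have hg1 : harm g = harm g.+1 - g.+1%:R^-1 by rewrite harmS addrK.
  rewrite hg1.
  transitivity (- 12 * e - 5 * (e * harm (5 * g.+1)) - e * g.+1%:R^-1
     + e * (harm g.+1 - 6 * harm (3 * h) - 2 * harm (2 * h))); first by ring.
  by rewrite HN gE; ring.
transitivity (f3 * f1 * (-4) ^+ h * f4 * (g.+1%:R * fg) * (punit (3 * D) * punit Y * punit (- 12 * harm h)));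
  first by ring.
by rewrite -EE; ring.
Qed.

Lemma fact256_odd g : h = (2 * g).+1 ->
  (4 * h)`!%:R * g`!%:R = - 12 * (5 * g + 3)`!%:R * (2 * h)`!%:R
    * punit (- 5 * harm (5 * g + 3) + 4 * harm h + harm g + 4 * D) :> R.
Proof.
move=> hg; have := @fact_dup (5 * g + 3) ltac:(lia).
have := @harm_dup (5 * g + 3) ltac:(lia).
have -> : (2 * (5 * g + 3) = (5 * h).+1)%N by lia.
have -> : (3 * h - (5 * g + 3) = g)%N by lia.
have hE5 : e * (5 * h).+1%:R^-1 = 6 * e.
  rewrite (@einv_plus 6 5 (5 * h).+1 1) /p; [|lia|lia|lia].
  by rewrite invr1; ring.
rewrite [e * (2 * _)]mulrCA harmS mulrDr harm_5h hE5 => HN.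
have {}HN : e * harm (5 * g + 3) = e * (3 * harm h - harm (2 * h) - harm g + 12).
  transitivity (e * (harm (5 * g + 3) - harm (3 * h) + harm g) + e * harm (3 * h) - e * harm g).
    by ring.
  by rewrite -HN harm_sixths; ring.
(* Duplication now produces [(5h + 1)!], and its extra factor satisfies [12(5h + 1) = 2(1 + 5p)]. *)
have g12 : 12 * (5 * h).+1%:R = 2 * punit 60.
  have -> : punit 60 = 1 + 5 * (12 * t) * e by rewrite /punit; ring.
  by rewrite t12 -(natr1 (5 * h)%N) (natrM _ 5); have -> : e = h%:R * 6 + 1; [rewrite hE|]; ring.
have hsign : (-1) ^+ h = - 1 :> R by rewrite hg exprS exprM sqrrN !expr1n mulr1.
have F1 : h`!%:R \is a @GRing.unit R by rewrite fact_unit // /p; lia.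
have F3 : (3 * h)`!%:R \is a @GRing.unit R by rewrite fact_unit // /p; lia.
have U4 : (-4) ^+ (5 * g + 3) \is a @GRing.unit R.
  by rewrite unitrX // unitrN (unit_small (m := 4)); lia.
have N4 : (-4) ^+ (5 * g + 3) = (-4) ^+ h * (2 * punit (3 * D)).
  by rewrite -(pow4_odd hg) -exprD; congr (_ ^+ _); lia.
have := fact_2h; have := fact_5h; rewrite hsign (factS (5 * h)) natrM.
set f1 := h`!%:R in F1 *; set f2 := (2 * h)`!%:R; set f4 := (4 * h)`!%:R.
set f3 := (3 * h)`!%:R in F3 *; set f5 := (5 * h)`!%:R; set fN := (5 * g + 3)`!%:R.
set fg := g`!%:R.
set X := - 5 * _ + _ + _ + _; set Y := - 6 * (_ - harm g).
move=> f51 f22 fND.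
apply: (mulrI U4); apply: (mulrI F3); apply: (mulrI F1).
apply: (mulIr (punit_unit Y)); apply: (mulIr (punit_unit (- 12 * harm h))).
transitivity (- 12 * f2 * f1 * punit X * punit (- 12 * harm h)
  * ((-4) ^+ (5 * g + 3) * fN * f3 * punit Y)); last by ring.
rewrite -fND.
transitivity (12 * (5 * h).+1%:R * punit X * f2 * fg * (f5 * f1 * - 1 * punit (- 12 * harm h))); last by ring.
rewrite f51 g12.
transitivity (2 * punit 60 * punit X * punit (- 12 * harm (2 * h)) * fg * f4 * (f2 * f2)); last by ring.
rewrite f22 N4; set Z := - 6 * _.
have EE : punit 60 * punit X * punit (- 12 * harm (2 * h)) * punit Z = punit (3 * D) * punit Y * punit (- 12 * harm h).
  rewrite -!punitD; apply: punit_eq; rewrite /X /Y /Z /D.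
  transitivity (60 * e - 5 * (e * harm (5 * g + 3))
     + e * (harm g - 6 * harm (3 * h) - 2 * harm (2 * h))); first by ring.
  by rewrite HN; ring.
transitivity (f3 * f1 * (-4) ^+ h * f4 * 2 * fg * (punit (3 * D) * punit Y * punit (- 12 * harm h)));
  first by ring.
by rewrite -EE; ring.
Qed.

(** The equation in [eval16_jac] has a solution, and that lemma identifies it; the case 256 is
    compared with this solution instead of being evaluated afresh. *)
Lemma jac_eval : 4 ^+ (8 * h * p) * jac ^+ 2 * (2 * h)`!%:R * h`!%:R * h`!%:R * punit (- 4 * D)
  = (-1) ^+ h * (4 * h)`!%:R * punit (- 8 * D).
Proof.
have U : (2 * h)`!%:R * h`!%:R * h`!%:R * punit (- 4 * D) \is a @GRing.unit R.
  by rewrite !unitrM punit_unit !fact_unit // /p; lia.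
have TE : (-1) ^+ h * (4 * h)`!%:R * punit (- 8 * D) / ((2 * h)`!%:R * h`!%:R * h`!%:R * punit (- 4 * D))
    * (2 * h)`!%:R * h`!%:R * h`!%:R * punit (- 4 * D) = (-1) ^+ h * (4 * h)`!%:R * punit (- 8 * D).
  by rewrite -!mulrA in U *; rewrite mulVr // mulr1.
by rewrite -(eval16_jac TE).
Qed.

Lemma eval256_jac (T : R) (m : nat) : uphalf (3 * h) = (m.+1 + h)%N ->
  T * h`!%:R * h`!%:R * m`!%:R * punit (harm h - harm m)
   = - 12 * (h + (m.+1 + h))`!%:R * punit (- 5 * (harm (h + (m.+1 + h)) - harm h)) ->
  T = (-1) ^+ h * (4 ^+ (8 * h * p) * jac ^+ 2).
Proof.
move=> mE.
have FF : (4 * h)`!%:R * m`!%:R = - 12 * (h + (m.+1 + h))`!%:R * (2 * h)`!%:R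
    * punit (- 5 * harm (h + (m.+1 + h)) + 4 * harm h + harm m + 4 * D) :> R.
  have [hm|hm] : h = (2 * m.+1)%N \/ h = (2 * m).+1 by lia.
    by rewrite (fact256_even hm); have -> : (h + (m.+1 + h) = 5 * m.+1)%N by lia.
  by rewrite (fact256_odd hm); have -> : (h + (m.+1 + h) = 5 * m + 3)%N by lia.
have F1 : h`!%:R \is a @GRing.unit R by rewrite fact_unit // /p; lia.
have F2 : (2 * h)`!%:R \is a @GRing.unit R by rewrite fact_unit // /p; lia.
have Fm : m`!%:R \is a @GRing.unit R by rewrite fact_unit // /p; lia.
move: FF jac_eval; set V := 4 ^+ _ * _; set N := (h + _)%N.
move=> FF VE TE.
apply: (mulIr F1); apply: (mulIr F1); apply: (mulIr Fm); apply: (mulIr (punit_unit (harm h - harm m))).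
apply: (mulIr F2); apply: (mulIr (punit_unit (- 4 * D))).
rewrite TE.
transitivity ((-1) ^+ h * (V * (2 * h)`!%:R * h`!%:R * h`!%:R * punit (- 4 * D)) * m`!%:R * punit (harm h - harm m));
  last by ring.
rewrite VE.
have s2 : (-1) ^+ h * (-1) ^+ h = 1 :> R by rewrite -expr2 sqrr_sign.
transitivity ((-1) ^+ h * (-1) ^+ h * ((4 * h)`!%:R * m`!%:R) * punit (- 8 * D) * punit (harm h - harm m));
  last by ring.
rewrite s2 FF mul1r -!mulrA; congr (_ * (_ * _)).
rewrite mulrCA -!punitD; congr (_ * punit _); ring.
Qed.

(** * Teichmüller representatives and their power sums *)

Lemma prime_dvd_natr m : (p %| m)%N -> e * m%:R = 0.
Proof. by case/dvdnP=> q ->; rewrite natrM -/e mulrCA e2 mulr0. Qed.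

Lemma exprD_e (x c : R) n :
  (x + e * c) ^+ n.+1 = x ^+ n.+1 + n.+1%:R * e * (x ^+ n * c).
Proof.
elim: n => [|n IH]; first by rewrite !expr1 expr0; ring.
rewrite exprSr IH -(natr1 n.+1) !exprSr.
transitivity (x ^+ n * x * x + (n.+1%:R + 1) * e * (x ^+ n * x * c)
  + (e * e) * (n.+1%:R * x ^+ n * c * c)); first by ring.
by rewrite e2 mul0r addr0.
Qed.

Lemma expr_modp (x c : R) : (x + e * c) ^+ p = x ^+ p.
Proof.
by rewrite -(prednK (prime_gt0 p_prime)) exprD_e (prednK (prime_gt0 p_prime)) -/e e2 mul0r addr0.
Qed.

(* [lifts x s]: the element [x] of [R], a ring with [p ^ 2 = 0], reduces to
   [s] in the field with [p] elements. *)
Definition lifts (x : R) (s : 'F_p) : Prop :=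
  exists (n : nat) (c : R), x = n%:R + e * c /\ s = n%:R.

Lemma lifts_nat n : lifts n%:R n%:R.
Proof. by exists n, 0; rewrite mulr0 addr0. Qed.
Lemma lifts1 : lifts 1 1. Proof. exact: (lifts_nat 1). Qed.
Lemma liftsM x y s u : lifts x s -> lifts y u -> lifts (x * y) (s * u).
Proof.
move=> [n [c [-> ->]]] [m [d [-> ->]]]; exists (n * m)%N, (c * m%:R + d * n%:R).
rewrite !natrM; split=> //.
transitivity (n%:R * m%:R + e * (c * m%:R + d * n%:R) + (e * e) * (c * d)); first by ring.
by rewrite e2 mul0r addr0.
Qed.
Lemma liftsN x s : lifts x s -> lifts (- x) (- s).
Proof.
move=> [n [c [-> ->]]]; exists (n * p.-1)%N, (- c - n%:R); split.
  rewrite natrM -subn1 natrB ?prime_gt0 // -/e; ring.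
have p0 : p%:R = 0 :> 'F_p by case/andP: (pchar_Fp p_prime) => _ /eqP.
by rewrite natrM -subn1 natrB ?prime_gt0 // p0; ring.
Qed.
Lemma liftsD x y s u : lifts x s -> lifts y u -> lifts (x + y) (s + u).
Proof.
move=> [n [c [-> ->]]] [m [d [-> ->]]]; exists (n + m)%N, (c + d).
by rewrite !natrD; split=> //; ring.
Qed.
Lemma liftsB x y s u : lifts x s -> lifts y u -> lifts (x - y) (s - u).
Proof. by move=> ls lu; apply/liftsD/liftsN. Qed.
Lemma liftsX x s n : lifts x s -> lifts (x ^+ n) (s ^+ n).
Proof.
move=> ls; elim: n => [|n IH]; first exact: lifts1.
by rewrite !exprS; apply: liftsM.
Qed.

Lemma Fp_natr (s : 'F_p) : s = (s : nat)%:R.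
Proof. by rewrite natr_Zp. Qed.

Lemma lifts_ex (s : 'F_p) : lifts (s : nat)%:R s.
Proof. by exists (s : nat), 0; rewrite mulr0 addr0 -Fp_natr. Qed.

Lemma lifts_unit x s : lifts x s -> s != 0 -> x \is a GRing.unit.
Proof.
move=> [n [c [-> ->]]] n0.
have nU : n%:R \is a @GRing.unit R.
  apply: natU; apply: contraNN n0 => /dvdnP[q ->].
  by rewrite natrM; case/andP: (pchar_Fp p_prime) => _ /eqP ->; rewrite mulr0.
apply/unitrPr; exists (n%:R^-1 - e * c * n%:R^-1 * n%:R^-1).
transitivity (n%:R * n%:R^-1 + e * c * n%:R^-1 - e * c * n%:R^-1 * (n%:R * n%:R^-1)
  - (e * e) * (c * c * n%:R^-1 * n%:R^-1)); first by ring.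
by rewrite e2 mul0r subr0 divrr // mulr1 addrK.
Qed.

(* The multiplicative (Teichmüller) lift, which exists modulo [p ^ 2] because
   a p-th power only depends on the class modulo [p]. *)
Definition teich (s : 'F_p) : R := (s : nat)%:R ^+ p.

Lemma teichE x s : lifts x s -> x ^+ p = teich s.
Proof.
move=> [n [c [-> ->]]]; rewrite expr_modp /teich val_Fp_nat //.
by rewrite {1}(divn_eq n p) natrD natrM -/e mulrC addrC expr_modp.
Qed.

Lemma Fp_fermat (s : 'F_p) : s ^+ p = s.
Proof. by have := expf_card s; rewrite card_Fp. Qed.

Lemma lifts_teich s : lifts (teich s) s.
Proof. by rewrite -[X in lifts _ X]Fp_fermat; apply/liftsX/lifts_ex. Qed.

Lemma teichM s u : teich (s * u) = teich s * teich u.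
Proof. by rewrite -(teichE (liftsM (lifts_ex s) (lifts_ex u))) exprMn. Qed.
Lemma teich1 : teich 1 = 1.
Proof. by rewrite -(teichE lifts1) expr1n. Qed.
Lemma teich0 : teich 0 = 0.
Proof. by rewrite /teich expr0n; case: p p_prime. Qed.
Lemma teichX s n : teich (s ^+ n) = teich s ^+ n.
Proof.
elim: n => [|n IH]; first exact: teich1.
by rewrite !exprS teichM IH.
Qed.
Lemma teich_frob s : teich s ^+ p = teich s.
Proof. by rewrite -teichX Fp_fermat. Qed.
Lemma teich_sub1 s : teich (1 - s) = (1 - teich s) ^+ p.
Proof. by rewrite (teichE (liftsB lifts1 (lifts_teich s))). Qed.
Lemma Fp_order (s : 'F_p) : s != 0 -> s ^+ (6 * h) = 1.
Proof.
move=> s0; apply: (mulIf s0); rewrite mul1r -exprSr.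
have pE : p = (6 * h).+1 by rewrite /p addn1.
by rewrite -pE Fp_fermat.
Qed.

Lemma card_Fp_neq0 : #|[pred s : 'F_p | s != 0]| = (6 * h)%N.
Proof.
have -> : (6 * h = #|'F_p|.-1)%N by rewrite card_Fp // /p addn1.
by rewrite -(cardC1 (0 : 'F_p)); apply: eq_card => s; rewrite !inE.
Qed.

(** Otherwise the polynomial [X^r - 1], with [r] the remainder of [m] modulo [p - 1], would have
    more than [r] roots. *)
Lemma Fp_nontrivial m : ~~ (6 * h %| m)%N -> exists2 g : 'F_p, g != 0 & g ^+ m != 1.
Proof.
move=> hm; case: (pickP [pred g : 'F_p | (g != 0) && (g ^+ m != 1)]) => [g /andP[]|none].
  by exists g.
have r0 : (0 < m %% (6 * h))%N by rewrite lt0n.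
have r1 : (m %% (6 * h) < 6 * h)%N by rewrite ltn_mod; lia.
have := @max_unity_roots _ (m %% (6 * h)) (enum [pred g : 'F_p | g != 0]) r0.
rewrite enum_uniq -cardE => /(_ _ isT).
have -> : #|[pred g : 'F_p | g != 0]| = (6 * h)%N.
  exact: card_Fp_neq0.
rewrite leqNgt r1 /= => H; suff: false by [].
apply: H; apply/allP => g; rewrite mem_enum inE => g0.
have := none g; rewrite /= g0 /= => /negbFE /eqP gm; apply/unity_rootP.
rewrite -gm [in RHS](divn_eq m (6 * h)) exprD [(_ %/ _ * _)%N]mulnC exprM.
by rewrite (Fp_order g0) expr1n mul1r.
Qed.

(** Orthogonality: replacing [s] by [g s] multiplies the sum by [teich g ^+ m], which for suitable
    [g] differs from 1 by a unit. Positivity of [m] makes the term at 0 vanish. *)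
Lemma sum_teichX m : (0 < m)%N ->
  \sum_(s : 'F_p) teich s ^+ m = (e - 1) * (6 * h %| m)%N%:R.
Proof.
move=> m0; case: (boolP (6 * h %| m)%N) => [/dvdnP[q mq]|hm].
  rewrite (bigD1 0) //= teich0 expr0n (gtn_eqF m0) add0r.
  rewrite (eq_bigr (fun _ => 1)) => [|s s0]; last first.
    by rewrite mq mulnC exprM -teichX Fp_order // teich1 expr1n.
  rewrite sumr_const mulr1.
  have -> : e - 1 = (6 * h)%:R by rewrite /e /p natrD addrK.
  by rewrite -card_Fp_neq0.
have [g g0 gm] := Fp_nontrivial hm.
rewrite mulr0; set S := \sum_(s : 'F_p) _.
have gU : teich g ^+ m - 1 \is a GRing.unit.
  apply: (@lifts_unit _ (g ^+ m - 1)); last by rewrite subr_eq0.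
  by apply/liftsB/lifts1/liftsX/lifts_teich.
apply: (mulrI gU); rewrite mulr0 mulrBl mul1r; apply/eqP; rewrite subr_eq0; apply/eqP.
rewrite [in RHS]/S [RHS](reindex_inj (mulfI g0)) /S mulr_sumr; apply: eq_bigr => s _.
by rewrite teichM exprMn.
Qed.

(** * Jacobi sums modulo [p^2] *)

Lemma bin_pred_p i : (i <= 6 * h)%N -> e * 'C(6 * h, i)%:R = e * (-1) ^+ i.
Proof.
elim: i => [|i IH] ih; first by rewrite bin0 expr0.
have pE : p = (6 * h).+1 by rewrite /p addn1.
have := prime_dvd_natr (@prime_dvd_bin i.+1 p p_prime ltac:(rewrite pE; lia)).
rewrite pE binS natrD mulrDr IH ?(ltnW ih) // => /eqP; rewrite addr_eq0 => /eqP ->.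
by rewrite exprS; ring.
Qed.

Lemma binomial_alt (x : R) n :
  (1 - x) ^+ n = \sum_(0 <= j < n.+1) (-1) ^+ j * 'C(n, j)%:R * x ^+ j.
Proof.
rewrite exprBn big_mkord; apply: eq_bigr => j _.
by rewrite expr1n mulr1 -mulr_natr mulrAC.
Qed.

(** The coefficient [C(p, i) = (p/i) C(p-1, i-1)] yields a truncated logarithm. At a Teichmüller
    representative [x^p = x], so this expands [teich (1 - s)] to first order. *)
Lemma expr_p_sub1 (x : R) :
  (1 - x) ^+ p = 1 - x ^+ p + e * - \sum_(0 <= i < 6 * h) (i.+1%:R)^-1 * x ^+ i.+1.
Proof.
have pE : p = (6 * h).+1 by rewrite /p addn1.
rewrite binomial_alt big_nat_recr //= binn [in X in X + _]pE big_nat_recl //= bin0 !expr0.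
have -> : (-1) ^+ p = -1 :> R.
  by rewrite pE exprS mulnC -[6%N]/(2 * 3)%N mulnCA exprM sqrrN !expr1n mulr1.
rewrite -sumrN mulr_sumr.
rewrite (eq_big_nat _ _ (F2 := fun i => e * - ((i.+1%:R)^-1 * x ^+ i.+1))); first by ring.
move=> i /andP[_ ih]; rewrite -?pE.
have iU : i.+1%:R \is a @GRing.unit R by rewrite unit_small // pE; lia.
apply: (mulrI iU).
transitivity ((-1) ^+ i.+1 * (i.+1 * 'C(p, i.+1))%N%:R * x ^+ i.+1).
  by rewrite natrM; ring.
have -> : (i.+1 * 'C(p, i.+1) = p * 'C(6 * h, i))%N by rewrite -mul_bin_diag {2}pE.
have -> : (p * 'C(6 * h, i))%N%:R = e * (-1) ^+ i by rewrite natrM bin_pred_p // ltnW.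
transitivity ((-1) ^+ i * (-1) ^+ i * (- e) * x ^+ i.+1); first by rewrite exprS; ring.
rewrite -expr2 sqrr_sign.
transitivity (- e * x ^+ i.+1 * (i.+1%:R * i.+1%:R^-1)); last by ring.
by rewrite divrr // mulr1 mul1r.
Qed.

Lemma sum_inv_dvdn a : \sum_(0 <= i < 6 * h) (i.+1%:R)^-1 * (6 * h %| a + i.+1)%N%:R
  = ((6 * h - a %% (6 * h))%N%:R)^-1 :> R.
Proof.
have M0 : (0 < 6 * h)%N by lia.
set M := (6 * h)%N in M0 *.
have rM : (a %% M < M)%N by rewrite ltn_mod.
have i0M : (M - a %% M - 1 < M)%N by lia.
rewrite big_mkord (bigD1 (Ordinal i0M)) //= big1 => [|i /eqP ii0].
  rewrite addr0 subn1 prednK ?subn_gt0 //.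
  have -> : (a + (M - a %% M) = (a %/ M).+1 * M)%N.
    by rewrite {1}(divn_eq a M) -addnA subnKC ?(ltnW rM) // mulSn addnC.
  by rewrite dvdn_mull ?mulr1.
rewrite (_ : (M %| a + i.+1)%N = false) ?mulr0 //.
apply/negP => /dvdnP[q aq]; apply: ii0; apply: val_inj => /=.
have iM := ltn_ord i; have aE := divn_eq a M.
have qE : (q * M = a %/ M * M + (a %% M + i.+1))%N by lia.
have q1 : q = (a %/ M).+1 by nia.
by rewrite q1 mulSn in qE; lia.
Qed.

(** The Jacobi sum of a power of the Teichmüller character with itself; [2h] and [4h] give the two
    cubic characters. *)
Definition jsum (A : nat) : R := \sum_(s : 'F_p) teich s ^+ A * teich (1 - s) ^+ A.

(** The main part keeps the exponents divisible by [p - 1], by orthogonality. In the first-order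
    part [sum_inv_dvdn] leaves a single reciprocal for each [j]. *)
Lemma jsum_expand B : jsum B.+1
  = (e - 1) * \sum_(0 <= j < B.+2) (-1) ^+ j * 'C(B.+1, j)%:R * (6 * h %| B.+1 + j)%N%:R
  + B.+1%:R * \sum_(0 <= j < B.+1) (-1) ^+ j * 'C(B, j)%:R
      * (e * ((6 * h - (B.+1 + j) %% (6 * h))%N%:R)^-1).
Proof.
have sumX n a : (0 < a)%N -> \sum_(s : 'F_p) teich s ^+ a * (1 - teich s) ^+ n
   = (e - 1) * \sum_(0 <= j < n.+1) (-1) ^+ j * 'C(n, j)%:R * (6 * h %| a + j)%N%:R.
  move=> a0; under eq_bigr => s _ do rewrite binomial_alt mulr_sumr.
  rewrite exchange_big /= mulr_sumr; apply: eq_bigr => j _.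
  transitivity ((-1) ^+ j * 'C(n, j)%:R * \sum_(s : 'F_p) teich s ^+ (a + j)).
    by rewrite mulr_sumr; apply: eq_bigr => s _; rewrite exprD; ring.
  by rewrite sum_teichX ?addn_gt0 ?a0 //; ring.
rewrite -sumX // /jsum.
transitivity (\sum_(s : 'F_p) (teich s ^+ B.+1 * (1 - teich s) ^+ B.+1
   + B.+1%:R * (- e * \sum_(0 <= i < 6 * h) (i.+1%:R)^-1 * (teich s ^+ (B.+1 + i.+1) * (1 - teich s) ^+ B)))).
  apply: eq_bigr => s _; rewrite teich_sub1 expr_p_sub1 teich_frob exprD_e mulrDr.
  congr (_ + _).
  transitivity (B.+1%:R * (- e * (teich s ^+ B.+1 * (1 - teich s) ^+ B * \sum_(0 <= i < 6 * h) (i.+1%:R)^-1 * teich s ^+ i.+1))).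
    by ring.
  congr (_ * (_ * _)); rewrite mulr_sumr; apply: eq_bigr => i _; rewrite exprD; ring.
rewrite big_split /=; congr (_ + _); rewrite -!mulr_sumr; congr (_ * _).
rewrite exchange_big /=.
transitivity (- e * \sum_(0 <= i < 6 * h) \sum_(0 <= j < B.+1)
   (e - 1) * ((-1) ^+ j * 'C(B, j)%:R * ((i.+1%:R)^-1 * (6 * h %| (B.+1 + j) + i.+1)%N%:R))).
  congr (_ * _); apply: eq_bigr => i _; rewrite -[LHS]mulr_sumr sumX ?addn_gt0 // !mulr_sumr.
  by apply: eq_bigr => j _; rewrite addnAC; ring.
rewrite exchange_big /= mulr_sumr; apply: eq_bigr => j _.
rewrite -!mulr_sumr sum_inv_dvdn; set X := _^-1.
transitivity ((-1) ^+ j * 'C(B, j)%:R * e * X - (e * e) * ((-1) ^+ j * 'C(B, j)%:R * X)); first by ring.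
by rewrite e2 mul0r subr0 mulrA.
Qed.

(** Euler's Beta integral in partial fractions, by Pascal's rule; the bound makes every denominator
    a unit. *)
Lemma beta_sum m x : (0 < x)%N -> (x + m < p)%N ->
  (\sum_(0 <= j < m.+1) (-1) ^+ j * 'C(m, j)%:R * ((x + j)%N%:R)^-1) * (x + m)`!%:R
  = (m`!)%:R * (x.-1)`!%:R :> R.
Proof.
elim: m x => [|m IH] x x0 xm.
  rewrite big_nat1 addn0 expr0 bin0 fact0; case: x x0 xm => // x _ xm.
  by rewrite factS natrM /= !mul1r mulKr ?unit_small //; lia.
rewrite big_nat_recl //.
rewrite (eq_big_nat _ _ (F2 := fun j => (-1) ^+ j.+1 * 'C(m, j.+1)%:R * ((x + j.+1)%N%:R)^-1
   - (-1) ^+ j * 'C(m, j)%:R * ((x.+1 + j)%N%:R)^-1)) => [|j _]; last first.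
  by rewrite binS natrD addSnnS exprS; ring.
rewrite sumrB.
have -> : (-1) ^+ 0 * 'C(m.+1, 0)%:R * ((x + 0)%N%:R)^-1
   = (-1) ^+ 0 * 'C(m, 0)%:R * ((x + 0)%N%:R)^-1 :> R by rewrite !bin0.
rewrite addrA -[_ + \sum_(0 <= i < m.+1) _](@big_nat_recl _ _ _ m.+1 0 (fun j => (-1) ^+ j * 'C(m, j)%:R * ((x + j)%N%:R)^-1)) //.
rewrite [\sum_(0 <= i < m.+2) _]big_nat_recr //= bin_small // mulr0 mul0r addr0.
have I1 := IH x x0 ltac:(lia); have I2 := IH x.+1 isT ltac:(lia).
set S1 := \sum_(0 <= _ < _) _ in I1 *; set S2 := \sum_(0 <= _ < _) _ in I2 *.
rewrite mulrBl {2}addnS -addSn I2 addnS (factS (x + m)) natrM mulrCA I1 /=.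
case: x x0 xm {I1 I2 S1 S2} => // x _ _; rewrite /= !factS !natrM.
by rewrite -!natr1 natrD -?natr1; ring.
Qed.

(** The exponents [2h + j] lie between [2h] and [4h], so the main part vanishes; the first-order
    part is a Beta sum, as [6h - (2h + j) = -(2h + 1 + j)] modulo [p]. *)
Lemma jsum_2h : jsum (2 * h) * jac = - e.
Proof.
have [B BE] : exists B, (2 * h)%N = B.+1 by exists (2 * h).-1; lia.
have F2 : (2 * h)`!%:R \is a @GRing.unit R by rewrite fact_unit // /p; lia.
rewrite {1}BE jsum_expand big_nat big1 => [|j /andP[_ jB]]; last first.
  by rewrite gtnNdvd ?mulr0 //; lia.
rewrite mulr0 add0r.
rewrite (eq_big_nat _ _ (F2 := fun j => - e * ((-1) ^+ j * 'C(B, j)%:R * ((2 * h + 1 + j)%N%:R)^-1)));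
  last first.
  move=> j /andP[_ jB]; rewrite modn_small; last lia.
  rewrite (@einv_minus 1 1 _ (2 * h + 1 + j)) /p; [ring|lia|lia|lia].
rewrite -mulr_sumr; have := @beta_sum B (2 * h + 1) ltac:(lia) ltac:(rewrite /p; lia).
have -> : (2 * h + 1 + B = 4 * h)%N by lia.
have -> : ((2 * h + 1).-1 = 2 * h)%N by lia.
set S := \sum_(0 <= _ < _) _ => SE; apply: (mulIr F2); apply: (mulIr F2).
transitivity (- e * B.+1%:R * S * (jac * (2 * h)`!%:R * (2 * h)`!%:R)); first by ring.
rewrite jacE; transitivity (- e * B.+1%:R * (S * (4 * h)`!%:R)); first by ring.
by rewrite SE {2}BE factS natrM; ring.
Qed.

Lemma bin_reflect_p a j : (j <= a)%N -> (a <= 6 * h)%N ->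
  e * ((-1) ^+ j * 'C(a, j)%:R) = e * 'C(6 * h - a + j, j)%:R.
Proof.
move=> + ah; elim: j => [|j IH] ja; first by rewrite !bin0 expr0; ring.
have jU : j.+1%:R \is a @GRing.unit R by rewrite unit_small // /p; lia.
apply: (mulrI jU).
transitivity ((-1) ^+ j.+1 * e * (j.+1 * 'C(a, j.+1))%N%:R); first by rewrite natrM; ring.
rewrite mul_bin_left; set b := (6 * h - a)%N in IH *.
transitivity (e * (j.+1 * 'C(b + j.+1, j.+1))%N%:R); last by rewrite natrM; ring.
rewrite addnS -mul_bin_diag /= !natrM natrB ?(ltnW ja) //.
transitivity ((j%:R - a%:R) * (e * ((-1) ^+ j * 'C(a, j)%:R))); first by rewrite exprS; ring.
rewrite IH ?(ltnW ja) //.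
have -> : a%:R = e - b%:R - 1 :> R.
  by rewrite /e; have -> : p = (a + b + 1)%N; [rewrite /p /b; lia|rewrite !natrD; ring].
transitivity ((b + j).+1%:R * e * 'C(b + j, j)%:R - e * e * 'C(b + j, j)%:R).
  by rewrite -natr1 natrD; ring.
by rewrite e2; ring.
Qed.

(** Both sides are the coefficient of [x^k] in [-(1-x)^(-m-1) log(1-x)]. *)
Lemma sum_bin_harm m k : (m + k < p)%N ->
  \sum_(0 <= j < k) 'C(m + j, j)%:R * ((k - j)%N%:R)^-1
  = 'C(m + k, k)%:R * (harm (m + k) - harm m).
Proof.
elim: m k => [|m IHm] k.
  rewrite add0n => kp; rewrite binn harm0 subr0 mul1r /harm big_nat_rev /=.
  apply: eq_big_nat => j /andP[_ jk]; rewrite add0n binn mul1r.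
  by congr (_%:R^-1); lia.
elim: k => [|k IHk] mk; first by rewrite big_geq // addn0 subrr mulr0.
rewrite big_nat_recl //.
rewrite (eq_big_nat _ _ (F2 := fun j => 'C(m + j.+1, j.+1)%:R * ((k.+1 - j.+1)%N%:R)^-1
   + 'C(m.+1 + j, j)%:R * ((k - j)%N%:R)^-1)); last first.
  by move=> j _; rewrite addnS binS natrD subSS addSnnS; ring.
rewrite big_split /= addrA.
have -> : 'C(m.+1 + 0, 0) = 'C(m + 0, 0) by rewrite !bin0.
rewrite -[X in X + _](@big_nat_recl _ _ _ k 0 (fun j => 'C(m + j, j)%:R * ((k.+1 - j)%N%:R)^-1)) //.
rewrite IHm ?IHk; [|lia|lia].
rewrite [in RHS]addSn [in RHS]addnS binS natrD !addnS !addSn (harmS (m + k).+1) (harmS m).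
have mU : m.+1%:R \is a @GRing.unit R by rewrite unit_small //; lia.
have mkU : (m + k).+2%:R \is a @GRing.unit R by rewrite unit_small //; lia.
have BE : 'C((m + k).+1, k.+1)%:R / m.+1%:R = ('C((m + k).+1, k.+1) + 'C((m + k).+1, k))%N%:R / (m + k).+2%:R :> R.
  apply: (mulIr mU); apply: (mulIr mkU); rewrite divrK // [RHS]mulrAC divrK // -!natrM; congr _%:R.
  have := mul_bin_down (m + k).+2 k.+1; rewrite binS /=.
  have -> : ((m + k).+2 - k.+1 = m.+1)%N by lia.
  by move=> E1; rewrite mulnC E1 mulnC.
move: BE; rewrite natrD; set i1 := m.+1%:R^-1; set i2 := (m + k).+2%:R^-1.
set c1 := 'C(_, _)%:R; set c2 := 'C(_, _)%:R => BE.
transitivity ((c1 + c2) * (harm (m + k).+1 - harm m) - c2 * i1); first by ring.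
transitivity ((c1 + c2) * (harm (m + k).+1 - harm m) - (c1 + c2) * i1 + (c1 + c2) * i2); last by ring.
by rewrite -BE; ring.
Qed.

(** Only [j = 2h] survives in the main part, giving [(p - 1) jac]; the first-order part amounts to
    [-p jac]. *)
Lemma jsum_4h : jsum (4 * h) = - jac.
Proof.
have [B BE] : exists B, (4 * h)%N = B.+1 by exists (4 * h).-1; lia.
rewrite {1}BE jsum_expand.
have -> : \sum_(0 <= j < B.+2) (-1) ^+ j * 'C(B.+1, j)%:R * (6 * h %| B.+1 + j)%N%:R = jac.
  have hB : (2 * h < B.+2)%N by lia.
  rewrite big_mkord (bigD1 (Ordinal hB)) //= big1 => [|j /eqP jh].
    have -> : (B.+1 + 2 * h = 6 * h)%N by lia.
    by rewrite dvdnn -BE /jac exprM sqrrN !expr1n mul1r mulr1 addr0.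
  rewrite (_ : (6 * h %| B.+1 + j)%N = false) ?mulr0 //.
  apply/negP => /dvdnP[q qE]; apply: jh; apply: val_inj => /=.
  by have jB := ltn_ord j; have q1 : q = 1%N; [nia | lia].
pose Z := \sum_(0 <= j < 2 * h) (-1) ^+ j * 'C(B, j)%:R * (e * ((2 * h - j)%N%:R)^-1).
have -> : \sum_(0 <= j < B.+1) (-1) ^+ j * 'C(B, j)%:R
      * (e * ((6 * h - (B.+1 + j) %% (6 * h))%N%:R)^-1) = 2 * Z.
  have hB : (2 * h <= B.+1)%N by lia.
  rewrite (big_cat_nat (leq0n _) hB) /= mulrDl mul1r; congr (_ + _).
    apply: eq_big_nat => j /andP[_ jh]; rewrite modn_small; last lia.
    by congr (_ * (_ * _%:R^-1)); lia.
  rewrite -{1}[(2 * h)%N]add0n big_addn.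
  have -> : (B.+1 - 2 * h = 2 * h)%N by lia.
  (* Under [j -> B - j] the sign changes because [B = 4h - 1] is odd, and so does the reciprocal
     modulo [p]; the two halves of the sum therefore agree. *)
  rewrite big_nat_rev /=; apply: eq_big_nat => j /andP[_ jh].
  have -> : (0 + 2 * h - j.+1 + 2 * h = B - j)%N by lia.
  rewrite bin_sub; last lia.
  have -> : (B.+1 + (B - j) = 6 * h + (2 * h - j.+1))%N by lia.
  rewrite modnDl modn_small; last lia.
  rewrite (@einv_minus 1 1 _ (2 * h - j)) /p; [|lia|lia|lia].
  have -> : (-1) ^+ (B - j) = - (-1) ^+ j :> R.
    have -> : (-1) ^+ j = (-1) ^+ (j + 2 * (B - j)) :> R.
      by rewrite exprD exprM sqrrN !expr1n mulr1.
    have -> : (j + 2 * (B - j) = (B - j) + B)%N by lia.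
    rewrite exprD; have -> : (-1) ^+ B = -1 :> R; last by ring.
    apply: (@mulrI _ (-1)); first by rewrite unitrN1.
    by rewrite -exprS -BE -[4%N]/(2 * 2)%N -mulnA exprM sqrrN !expr1n; ring.
  by ring.
have ZE : Z = e * ('C(2 * h + 1 + 2 * h, 2 * h)%:R * (harm (2 * h + 1 + 2 * h) - harm (2 * h + 1))).
  rewrite -sum_bin_harm; last by rewrite /p; lia.
  rewrite mulr_sumr; apply: eq_big_nat => j /andP[_ jh].
  transitivity (e * ((-1) ^+ j * 'C(B, j)%:R) * ((2 * h - j)%N%:R)^-1); first by ring.
  rewrite bin_reflect_p; [|lia|lia].
  by have -> : (6 * h - B + j = 2 * h + 1 + j)%N; [lia|rewrite mulrA].
have h1 : e * harm (2 * h + 1 + 2 * h) = e * harm (2 * h) + 3 * e.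
  have -> : (2 * h + 1 + 2 * h = (4 * h).+1)%N by lia.
  rewrite harmS mulrDr harm_4h (@einv_plus 3 2 (4 * h).+1 1) /p; [|lia|lia|lia].
  by rewrite invr1; ring.
have h2 : 2 * (e * harm (2 * h + 1)) = 2 * (e * harm (2 * h)) + 3 * e.
  rewrite addn1 harmS mulrDr (@einv_plus 3 1 (2 * h).+1 2) /p; [|lia|lia|lia].
  have U2 : 2 \is a @GRing.unit R by rewrite (unit_small (m := 2)); lia.
  transitivity (2 * (e * harm (2 * h)) + 3 * e * (2 * 2^-1)); first by ring.
  by rewrite divrr // mulr1.
have cE : 2 * (e * 'C(2 * h + 1 + 2 * h, 2 * h)%:R) = e * jac.
  have U : (2 * h).+1%:R \is a @GRing.unit R by rewrite unit_small // /p; lia.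
  have U3 : 3 \is a @GRing.unit R by rewrite (unit_small (m := 3)); lia.
  apply: (mulrI U3); apply: (mulrI U).
  transitivity (2 * 3 * e * ((2 * h).+1 * 'C((4 * h).+1, 2 * h))%N%:R).
    by have -> : (2 * h + 1 + 2 * h = (4 * h).+1)%N; [lia|rewrite natrM; ring].
  have := mul_bin_down (4 * h).+1 (2 * h); have -> : ((4 * h).+1 - 2 * h = (2 * h).+1)%N by lia.
  move=> <-; rewrite natrM -pred_Sn -/jac.
  have h4 : 3 * (4 * h).+1%:R = 2 * e + 1 :> R.
    by rewrite /e -!natrM natr1; congr _%:R; rewrite /p; lia.
  have h5 : 3 * (2 * h).+1%:R = e + 2 :> R.
    by rewrite /e -natrM -natrD; congr _%:R; rewrite /p; lia.
  transitivity (2 * e * (3 * (4 * h).+1%:R) * jac); first by ring.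
  transitivity (e * (3 * (2 * h).+1%:R) * jac); last by ring.
  rewrite h4 h5; transitivity (2 * e * jac + 4 * (e * e) * jac); first by ring.
  by rewrite e2; transitivity (e * e * jac + 2 * e * jac); [rewrite e2; ring|ring].
have U4 : 4 \is a @GRing.unit R by rewrite (unit_small (m := 4)); lia.
have Z4 : 4 * Z = 3 * (e * jac).
  rewrite ZE; set c := 'C(_, _)%:R in cE *.
  transitivity (2 * (2 * c) * (e * harm (2 * h + 1 + 2 * h)) - 2 * c * (2 * (e * harm (2 * h + 1)))).
    by ring.
  rewrite h1 h2; transitivity (3 * (2 * (e * c))); first by ring.
  by rewrite cE.
rewrite -BE.
transitivity ((e - 1) * jac + 2 * h%:R * (4 * Z)); first by rewrite natrM; ring.
rewrite Z4; transitivity ((e - 1) * jac + (h%:R * 6) * e * jac); first by ring.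
rewrite hE; transitivity (- jac + e * e * jac); first by ring.
by rewrite e2 mul0r addr0.
Qed.

(** * The symmetric form of the Jacobi sum and its norm *)

Lemma Fp_neq0 m : (0 < m < p)%N -> m%:R != 0 :> 'F_p.
Proof.
by case/andP=> m0 mp; rewrite -val_eqE /= val_Fp_nat // modn_small // -lt0n.
Qed.

Definition ksum (A : nat) : R := \sum_(u : 'F_p) teich (1 - u ^+ 2) ^+ A.

(** The substitution [u = 1 - 2s] turns [1 - u^2] into [4s(1 - s)], and [teich 4] is [4^p]. *)
Lemma ksum_jsum A : ksum A = 4 ^+ (p * A) * jsum A.
Proof.
have two0 : 2 != 0 :> 'F_p by apply: (@Fp_neq0 2); lia.
have inj : injective (fun s : 'F_p => 1 - 2 * s).
  by move=> s u /addrI /oppr_inj /(mulfI two0).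
rewrite /ksum (reindex_inj inj) /jsum mulr_sumr; apply: eq_bigr => s _.
have -> : 1 - (1 - 2 * s) ^+ 2 = 4%:R * (s * (1 - s)) by ring.
by rewrite !teichM -(teichE (lifts_nat 4)) !exprMn exprM.
Qed.

Lemma sum_Fp (f : 'F_p -> R) : \sum_(u : 'F_p) f u = \sum_(0 <= i < p) f i%:R.
Proof.
rewrite (eq_bigr (fun u : 'F_p => f (u : nat)%:R)) => [|u _]; last by rewrite -Fp_natr.
rewrite -(big_mkord xpredT (fun i => f i%:R)).
have H (g : nat -> R) N N' : N = N' -> \sum_(0 <= i < N) g i = \sum_(0 <= i < N') g i by move->.
by apply: H; apply: Fp_cast.
Qed.

Lemma ksum_half A : (0 < A)%N -> ksum A
  = 1 + 2 * \sum_(0 <= i < 3 * h) teich (1 - (i.+1%:R) ^+ 2) ^+ A.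
Proof.
move=> A0; have range_p (g : nat -> R) : \sum_(0 <= i < p) g i = \sum_(0 <= i < (6 * h).+1) g i.
  by rewrite /p addn1.
rewrite /ksum sum_Fp range_p big_nat_recl //.
rewrite expr0n subr0 teich1 expr1n; congr (_ + _).
have h3 : (3 * h <= 6 * h)%N by lia.
rewrite (big_cat_nat (leq0n _) h3) /= mulrDl mul1r; congr (_ + _).
rewrite -{1}[(3 * h)%N]add0n big_addn; have -> : (6 * h - 3 * h = 3 * h)%N by lia.
rewrite big_nat_rev; apply: eq_big_nat => i /andP[_ ih] /=.
congr (teich (1 - _) ^+ _); rewrite -[RHS]sqrrN; congr (_ ^+ 2); apply/eqP.
rewrite -addr_eq0 -natrD.
have -> : ((0 + 3 * h - i.+1 + 3 * h).+1 + i.+1 = p)%N by rewrite /p; lia.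
by case/andP: (pchar_Fp p_prime).
Qed.

(** The power of 4 that remains lies in [1 + pR], so it acts trivially on [e]. *)
Lemma ksum_prod : ksum (4 * h) * ksum (2 * h) = e.
Proof.
rewrite !ksum_jsum jsum_4h; transitivity (4 ^+ (p * (6 * h)) * - (jsum (2 * h) * jac)).
  have -> : (p * (6 * h) = p * (4 * h) + p * (2 * h))%N by lia.
  by rewrite exprD; ring.
rewrite jsum_2h opprK.
have -> : (4 : R) ^+ (p * (6 * h)) = (2 ^+ (6 * h)) ^+ (2 * p).
  have -> : (4 : R) = 2 ^+ 2 by ring.
  by rewrite -!exprM; congr (_ ^+ _); lia.
rewrite pow2_D punitX /punit; set x := _ * t.
by transitivity (e + e * e * x); [ring|rewrite e2 mul0r addr0].
Qed.

Lemma ksum_sq : ksum (4 * h) ^+ 2 = 4 ^+ (8 * h * p) * jac ^+ 2.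
Proof.
rewrite ksum_jsum jsum_4h exprMn sqrrN -exprM; congr (_ ^+ _ * _); lia.
Qed.

Lemma jac_unit : jac \is a GRing.unit.
Proof.
have : (4 * h)`!%:R \is a @GRing.unit R by rewrite fact_unit // /p; lia.
by rewrite -jacE !unitrM => /andP[/andP[]].
Qed.

Lemma ksum_unit : ksum (4 * h) \is a GRing.unit.
Proof.
by rewrite ksum_jsum jsum_4h unitrM unitrN jac_unit unitrX // (unit_small (m := 4)); lia.
Qed.

(** The [b]'s count the [u] from 1 to [(p-1)/2] at which the cubic character of [1 - u^2] is [1],
    [w] or [w^2]; passing to the exponent [2h] exchanges [w] and [w^2]. The bound is strict because
    [u = 1] contributes 0. *)
Lemma ksum_coords : exists b0 b1 b2 : nat, exists2 w : R, 1 + w + w ^+ 2 = 0 &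
  [/\ ksum (4 * h) = 1 + 2 * (b0%:R + b1%:R * w + b2%:R * w ^+ 2),
      ksum (2 * h) = 1 + 2 * (b0%:R + b1%:R * w ^+ 2 + b2%:R * w) &
      (b0 + b1 + b2 < 3 * h)%N].
Proof.
have [g g0 g1] := @Fp_nontrivial (2 * h) ltac:(rewrite gtnNdvd //; lia).
set z := g ^+ (2 * h) in g1.
have z3 : z ^+ 3 = 1.
  by rewrite /z -exprM; have -> : (2 * h * 3 = 6 * h)%N; [lia|exact: Fp_order].
have z0 : z != 0 by rewrite expf_neq0.
have zz : 1 + z + z ^+ 2 = 0.
  have d : z - 1 != 0 by rewrite subr_eq0.
  by apply: (mulfI d); rewrite mulr0; transitivity (z ^+ 3 - 1); [ring|rewrite z3 subrr].
have z21 : z ^+ 2 != 1.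
  by apply: contraNneq g1 => H; apply/eqP; have := z3; rewrite exprS H mulr1.
have z2z : z ^+ 2 != z.
  by apply: contraNneq g1 => H; apply/eqP/(mulfI z0); rewrite -expr2 H mulr1.
pose w := teich z.
have ww : 1 + w + w ^+ 2 = 0.
  have d : w - 1 \is a GRing.unit.
    apply: (@lifts_unit _ (z - 1)); last by rewrite subr_eq0.
    exact/liftsB/lifts1/lifts_teich.
  apply: (mulrI d); rewrite mulr0; transitivity (w ^+ 3 - 1); first by ring.
  by rewrite -teichX z3 teich1 subrr.
have w4 : w ^+ 4 = w by rewrite -teichX exprS z3 mulr1.
have cube (y : 'F_p) : y ^+ 3 = 1 -> [\/ y = 1, y = z | y = z ^+ 2].
  move=> y3; have : (y - 1) * (y - z) * (y - z ^+ 2) == 0.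
    have -> : (y - 1) * (y - z) * (y - z ^+ 2)
      = y ^+ 3 - 1 - (1 + z + z ^+ 2) * y ^+ 2 + z * (1 + z + z ^+ 2) * y - (z ^+ 3 - 1) by ring.
    by rewrite y3 z3 zz !subrr; apply/eqP; ring.
  rewrite !mulf_eq0 !subr_eq0 => /orP[/orP[]|] /eqP; [exact: Or31|exact: Or32|exact: Or33].
pose Y i : 'F_p := (1 - (i.+1%:R) ^+ 2) ^+ (4 * h).
have Ycase i : Y i = 0 \/ [\/ Y i = 1, Y i = z | Y i = z ^+ 2].
  rewrite /Y; set x := 1 - _; case: (eqVneq x 0) => [->|x0].
    by left; rewrite expr0n; case: h h_gt0.
  right; apply: cube; rewrite -exprM.
  by have -> : (4 * h * 3 = 6 * h * 2)%N; [lia|rewrite exprM Fp_order // expr1n].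
have Y4 i : teich (1 - (i.+1%:R) ^+ 2) ^+ (4 * h) = teich (Y i) by rewrite /Y teichX.
have Y2 i : teich (1 - (i.+1%:R) ^+ 2) ^+ (2 * h) = teich (Y i) ^+ 2.
  rewrite /Y; set x := 1 - _; rewrite -!teichX -exprM; congr teich.
  case: (eqVneq x 0) => [->|x0]; first by rewrite !expr0n; case: h h_gt0.
  have -> : (4 * h * 2 = 2 * h + 6 * h)%N by lia.
  by rewrite exprD Fp_order // mulr1.
have T4 i : teich (Y i) = (Y i == 1)%:R + (Y i == z)%:R * w + (Y i == z ^+ 2)%:R * w ^+ 2.
  case: (Ycase i) => [->|[] ->].
  - by rewrite teich0 eq_sym oner_eq0 eq_sym (negPf z0) eq_sym expf_eq0 (negPf z0) !mul0r !addr0.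
  - by rewrite eqxx eq_sym (negPf g1) eq_sym (negPf z21) teich1 !mul0r !addr0.
  - by rewrite (negPf g1) eqxx [z == _]eq_sym (negPf z2z) !mul0r !addr0 add0r mul1r.
  - by rewrite (negPf z21) (negPf z2z) eqxx !mul0r !add0r mul1r teichX.
have T2 i : teich (Y i) ^+ 2 = (Y i == 1)%:R + (Y i == z)%:R * w ^+ 2 + (Y i == z ^+ 2)%:R * w.
  case: (Ycase i) => [->|[] ->].
  - rewrite teich0 eq_sym oner_eq0 eq_sym (negPf z0) eq_sym expf_eq0 (negPf z0) !mul0r !addr0.
    by rewrite expr0n.
  - by rewrite eqxx eq_sym (negPf g1) eq_sym (negPf z21) teich1 expr1n !mul0r !addr0.
  - by rewrite (negPf g1) eqxx [z == _]eq_sym (negPf z2z) !mul0r !addr0 add0r mul1r.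
  - by rewrite (negPf z21) (negPf z2z) eqxx !mul0r !add0r mul1r teichX -exprM.
exists (\sum_(0 <= i < 3 * h) (Y i == 1)%R)%N, (\sum_(0 <= i < 3 * h) (Y i == z)%R)%N,
  (\sum_(0 <= i < 3 * h) (Y i == z ^+ 2)%R)%N, w => //; split.
- rewrite ksum_half; last lia.
  congr (_ + _ * _); rewrite !natr_sum !mulr_suml -!big_split.
  by apply: eq_bigr => i _; rewrite Y4 {1}T4.
- rewrite ksum_half; last lia.
  congr (_ + _ * _); rewrite !natr_sum !mulr_suml -!big_split.
  by apply: eq_bigr => i _; rewrite Y2 {1}T2.
rewrite -!big_split /=; have -> : (3 * h = (3 * h).-1.+1)%N by lia.
rewrite big_nat_recl // ltnS.
have -> : Y 0%N = 0 by rewrite /Y expr1n subrr expr0n; case: h h_gt0.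
rewrite eq_sym oner_eq0 eq_sym (negPf z0) eq_sym expf_eq0 (negPf z0) /= add0n.
rewrite -[X in (_ <= X)%N]subn0 -[X in (_ <= X)%N]muln1 -sum_nat_const_nat.
apply: leq_sum => i _; case: (Ycase i.+1) => [->|[] ->].
- by rewrite eq_sym oner_eq0 eq_sym (negPf z0) eq_sym expf_eq0 (negPf z0).
- by rewrite eqxx eq_sym (negPf g1) eq_sym (negPf z21).
- by rewrite (negPf g1) eqxx [z == _]eq_sym (negPf z2z).
- by rewrite (negPf z21) (negPf z2z) eqxx.
Qed.

Hypothesis natR_eq0 : forall m : nat, m%:R = 0 :> R -> (p ^ 2 %| m)%N.

(** The norm equals [p] modulo [p^2]. The counts give [a^2 + 3b^2 <= (1 + 2(b0+b1+b2))^2 < p^2], so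
    the equality holds among integers. *)
Lemma ksum_norm : exists a b : int, exists2 s : R, s ^+ 2 = -3 &
  [/\ ksum (4 * h) = a%:~R + b%:~R * s, ksum (2 * h) = a%:~R - b%:~R * s &
      p%:Z = a ^+ 2 + 3 * b ^+ 2].
Proof.
have [b0 [b1 [b2 [w ww [K4 K2 bb]]]]] := ksum_coords.
have w2 : w ^+ 2 = - 1 - w.
  by apply/eqP; rewrite -subr_eq0; apply/eqP; rewrite -[RHS]ww; ring.
(* With [s = 2w + 1] one has [2w = s - 1] and [2w^2 = -1 - s]. *)
pose a : int := 1 + 2 * b0%:Z - b1%:Z - b2%:Z; pose b : int := b1%:Z - b2%:Z.
have aR : a%:~R = 1 + 2 * b0%:R - b1%:R - b2%:R :> R.
  by rewrite /a !rmorphB rmorphD rmorphM /= !natz.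
have bR : b%:~R = b1%:R - b2%:R :> R by rewrite /b rmorphB.
have s2 : (2 * w + 1) ^+ 2 = -3 :> R.
  by transitivity (4 * w ^+ 2 + 4 * w + 1); [ring|rewrite w2; ring].
have K4' : ksum (4 * h) = a%:~R + b%:~R * (2 * w + 1) by rewrite K4 aR bR w2; ring.
have K2' : ksum (2 * h) = a%:~R - b%:~R * (2 * w + 1) by rewrite K2 aR bR w2; ring.
exists a, b, (2 * w + 1) => //; split=> //.
have := ksum_prod; rewrite K4' K2' => KK.
have NR : (a ^+ 2 + 3 * b ^+ 2 - p%:Z)%:~R = 0 :> R.
  have pR : p%:Z%:~R = e by [].
  rewrite !expr2 rmorphB rmorphD !rmorphM /= pR -KK.
  transitivity (b%:~R ^+ 2 * ((2 * w + 1) ^+ 2 + 3) : R); first by ring.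
  by rewrite s2; ring.
have dvd : (p ^ 2 %| absz (a ^+ 2 + 3 * b ^+ 2 - p%:Z)%R)%N.
  apply: natR_eq0; move: NR; set N := _ - _.
  by case: (intP N) => [|n|n] //=; rewrite ?abszN //= mulrNz => /eqP; rewrite oppr_eq0 => /eqP.
have aE : a ^+ 2 + 3 * b ^+ 2 = (1 + 2 * (b0 + b1 + b2)%N%:Z) ^+ 2
    - 6 * b1%:Z - 6 * b2%:Z - 12 * (b0%:Z * b1%:Z + b0%:Z * b2%:Z + b1%:Z * b2%:Z).
  by rewrite /a /b !PoszD; ring.
have small : (absz (a ^+ 2 + 3 * b ^+ 2 - p%:Z)%R < p ^ 2)%N.
  have a2 : 0 <= a ^+ 2 by exact: sqr_ge0.
  have b22 : 0 <= b ^+ 2 by exact: sqr_ge0.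
  have l1 : (1 + 2 * (b0 + b1 + b2)%N%:Z) ^+ 2 < p%:Z ^+ 2.
    by rewrite ltr_pXn2r ?nnegrE //; rewrite /p; lia.
  have l2 : 0 <= b0%:Z * b1%:Z + b0%:Z * b2%:Z + b1%:Z * b2%:Z by rewrite !addr_ge0 ?mulr_ge0.
  have pp : (p ^ 2)%N%:Z = p%:Z ^+ 2 by rewrite -mulnn expr2 PoszM.
  have p2 : p%:Z < p%:Z ^+ 2 by rewrite expr2 -PoszM ltz_nat ltn_Pmull ?prime_gt0 ?prime_gt1.
  by rewrite -ltz_nat abszE pp ltr_norml; apply/andP; split; lia.
have : absz (a ^+ 2 + 3 * b ^+ 2 - p%:Z)%R == 0%N.
  by apply: contraTT dvd => n0; rewrite gtnNdvd // lt0n.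
by rewrite absz_eq0 subr_eq0 => /eqP ->.
Qed.

(** The conjugate sum has square 0, since its product with a unit is [p]. Adding that square gives
    [2a^2 - 6b^2 = 4a^2 - 2p], and [a^2 = x^2]. *)
Lemma jac_sq (x y : int) : p%:Z = x ^+ 2 + 3 * y ^+ 2 ->
  4 ^+ (8 * h * p) * jac ^+ 2 = 4 * (x ^+ 2)%:~R - 2 * e.
Proof.
move=> px; have [a [b [s s2 [K4 K2 pab]]]] := ksum_norm.
rewrite (norm_form_unique _ _ _ _ _ p_prime px pab) -ksum_sq.
have eR : e = (a ^+ 2)%:~R + 3 * (b ^+ 2)%:~R.
  by transitivity ((p%:Z)%:~R : R); rewrite // pab rmorphD rmorphM.
have K20 : ksum (2 * h) ^+ 2 = 0.
  apply: (mulrI ksum_unit); apply: (mulrI ksum_unit); rewrite !mulr0.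
  transitivity ((ksum (4 * h) * ksum (2 * h)) * (ksum (4 * h) * ksum (2 * h))); first by ring.
  by rewrite ksum_prod e2.
transitivity (ksum (4 * h) ^+ 2 + ksum (2 * h) ^+ 2); first by rewrite K20 addr0.
rewrite K4 K2 eR !expr2 !rmorphM.
transitivity (2 * (a%:~R * a%:~R) + 2 * (b%:~R * b%:~R) * s ^+ 2 : R); first by ring.
by rewrite s2; ring.
Qed.
End ModPSquare.

(** * Reduction of rational numbers *)

Section Reduction.
Set Implicit Arguments. Unset Strict Implicit. Unset Printing Implicit Defensive.
Variables (R : comUnitRingType) (p : nat).
Hypothesis p_prime : prime p.
Hypothesis natU : forall m : nat, ~~ (p %| m)%N -> m%:R \is a @GRing.unit R.
Hypothesis natR_eq0 : forall m : nat, m%:R = 0 :> R -> (p ^ 2 %| m)%N.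

(* The graph of the reduction map from the p-integral rationals to [R]. *)
Definition reduces (x : rat) (r : R) : Prop :=
  exists (a : int) (b : nat), [/\ ~~ (p %| b)%N, x * b%:R = a%:~R & r * b%:R = a%:~R].

Let p1 : ~~ (p %| 1)%N.
Proof. by rewrite dvdn1; apply: contraTneq p_prime => ->. Qed.

Lemma reduces_frac (x : rat) (r : R) (a b : int) :
  ~~ (p %| absz b)%N -> x * b%:~R = a%:~R -> r * b%:~R = a%:~R -> reduces x r.
Proof.
move=> pb xE rE; exists (Num.sg b * a), (absz b).
have nE (S : comUnitRingType) : (absz b)%:R = (Num.sg b)%:~R * b%:~R :> S.
  by rewrite pmulrn abszE normrEsg rmorphM.
by rewrite !nE !rmorphM /= -xE; split=> //; [ring | rewrite -rE; ring].
Qed.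

Lemma reduces_int (a : int) : reduces a%:~R a%:~R.
Proof. by exists a, 1%N; rewrite !mulr1. Qed.
Lemma reduces_nat (n : nat) : reduces n%:R n%:R.
Proof. exact: (reduces_int n). Qed.

Lemma reducesD x y r s : reduces x r -> reduces y s -> reduces (x + y) (r + s).
Proof.
move=> [a [b [pb xE rE]]] [c [d [pd yE sE]]].
exists (a * d%:Z + c * b%:Z), (b * d)%N; rewrite Euclid_dvdM // negb_or pb pd.
rewrite !natrM !rmorphD !rmorphM /= -xE -yE -rE -sE -!pmulrn; split=> //; ring.
Qed.

Lemma reducesM x y r s : reduces x r -> reduces y s -> reduces (x * y) (r * s).
Proof.
move=> [a [b [pb xE rE]]] [c [d [pd yE sE]]].
exists (a * c), (b * d)%N; rewrite Euclid_dvdM // negb_or pb pd.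
rewrite !natrM !rmorphM /= -xE -yE -rE -sE; split=> //; ring.
Qed.

Lemma reducesN x r : reduces x r -> reduces (- x) (- r).
Proof.
move=> [a [b [pb xE rE]]]; exists (- a), b; split=> //.
  by rewrite rmorphN /= -xE mulNr.
by rewrite rmorphN /= -rE mulNr.
Qed.

Lemma reducesB x y r s : reduces x r -> reduces y s -> reduces (x - y) (r - s).
Proof. by move=> rx ry; apply/reducesD/reducesN. Qed.

Lemma reducesX x r n : reduces x r -> reduces (x ^+ n) (r ^+ n).
Proof.
move=> rx; elim: n => [|n IH]; first exact: (reduces_nat 1).
by rewrite !exprS; apply: reducesM.
Qed.

Lemma reducesV_nat n : ~~ (p %| n)%N -> reduces (n%:R)^-1 (n%:R)^-1.
Proof.
move=> pn; exists 1, n; split=> //; last by rewrite mulVr ?natU.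
by rewrite mulVf // pnatr_eq0; apply: contraNneq pn => ->; rewrite dvdn0.
Qed.

Lemma reduces_div_nat x r n : ~~ (p %| n)%N -> reduces x r -> reduces (x / n%:R) (r / n%:R).
Proof. by move=> pn rx; apply/reducesM/reducesV_nat. Qed.

Lemma reduces_sum m n (f : nat -> rat) (g : nat -> R) :
  (forall i, (m <= i < n)%N -> reduces (f i) (g i)) ->
  reduces (\sum_(m <= i < n) f i) (\sum_(m <= i < n) g i).
Proof.
move=> fg; rewrite big_nat [X in reduces _ X]big_nat.
by apply: (big_ind2 reduces) => //; [exact: (reduces_nat 0) | move=> *; exact: reducesD].
Qed.

Lemma reduces_prod m n (f : nat -> rat) (g : nat -> R) :
  (forall i, (m <= i < n)%N -> reduces (f i) (g i)) ->
  reduces (\prod_(m <= i < n) f i) (\prod_(m <= i < n) g i).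
Proof.
move=> fg; rewrite big_nat [X in reduces _ X]big_nat.
by apply: (big_ind2 reduces) => //; [exact: (reduces_nat 1) | move=> *; exact: reducesM].
Qed.

Lemma reduces_fun x r s : reduces x r -> reduces x s -> r = s.
Proof.
move=> [a [b [pb xE rE]]] [c [d [pd yE sE]]].
apply: (mulIr (natU pb)); apply: (mulIr (natU pd)).
rewrite rE [RHS]mulrAC sE.
have : a * d%:Z = c * b%:Z.
  by apply: (@intr_inj rat); rewrite !rmorphM /= -xE -yE -!pmulrn; ring.
by move/(congr1 (fun z : int => z%:~R : R)); rewrite !rmorphM.
Qed.

Lemma dvd_denq (x : rat) (m : nat) (a : int) : x * m%:R = a%:~R -> (`|denq x| %| m)%N.
Proof.
move=> xm.
have E : numq x * m%:Z = a * denq x.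
  apply: (@intr_inj rat); rewrite !rmorphM /= -xm -!pmulrn.
  have xE : x * (denq x)%:~R = (numq x)%:~R.
    by rewrite -{1}(divq_num_den x) divfK // intr_eq0 denq_neq0.
  by rewrite -xE; ring.
have /(congr1 absz) := E; rewrite !abszM /= => E'.
have : (`|denq x| %| `|numq x| * m)%N by rewrite E' dvdn_mull.
by rewrite Gauss_dvdr // coprime_sym coprime_num_den.
Qed.

(** The cross difference [ad - cb] vanishes in [R], so [p^2] divides it, while [bd] is prime to
    [p]. *)
Lemma reduces_congr x y r : reduces x r -> reduces y r -> rat_congr p 2 x y.
Proof.
move=> [a [b [pb xE rE]]] [c [d [pd yE sE]]].
pose N := a * d%:Z - c * b%:Z.
have NR : N%:~R = 0 :> R.
  by rewrite rmorphB !rmorphM /= -rE -sE -!pmulrn; ring.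
have /dvdnP[q qN] : (p ^ 2 %| absz N)%N.
  apply: natR_eq0; move: NR; case: (intP N) => [|n|n] //=.
  by rewrite ?abszN mulrNz => /eqP; rewrite oppr_eq0 => /eqP.
have b0 : b%:R != 0 :> rat by rewrite pnatr_eq0; apply: contraNneq pb => ->; rewrite dvdn0.
have d0 : d%:R != 0 :> rat by rewrite pnatr_eq0; apply: contraNneq pd => ->; rewrite dvdn0.
have NE : N = (p ^ 2)%N%:Z * (Num.sg N * q%:Z).
  by rewrite {1}[N]numEsg -abszE qN PoszM; ring.
have NQ : (x - y) * (b%:R * d%:R) = N%:~R.
  by rewrite rmorphB !rmorphM /= -xE -yE -!pmulrn; ring.
exists ((Num.sg N * q%:Z)%:~R / (b%:R * d%:R)).
have bd0 : b%:R * d%:R != 0 :> rat by rewrite mulf_neq0.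
split.
  by apply: (mulIf bd0); rewrite NQ -[RHS]mulrA divfK // [in LHS]NE rmorphM.
have H : (Num.sg N * q%:Z)%:~R / (b%:R * d%:R) * (b * d)%N%:R = (Num.sg N * q%:Z)%:~R :> rat.
  by rewrite natrM divfK.
have := dvd_denq H; move=> /coprime_dvdl; apply.
by rewrite coprime_sym prime_coprime // Euclid_dvdM // negb_or pb pd.
Qed.
End Reduction.

(** * The products in the closed forms as progressions shifted by multiples of [p] *)

Lemma prod_num16 h : \prod_(h <= l < 4 * h) (2 * (6 * h + 1)%N%:R + - 3 * l.+1%:R)
  = \prod_(0 <= j < 3 * h) (3 * j%:R + 2) :> rat.
Proof.
rewrite -{1}[h]add0n big_addn; have -> : (4 * h - h = 3 * h)%N by lia.
rewrite big_nat_rev /=; apply: eq_big_nat => j /andP[_ jn].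
have -> : (0 + 3 * h - j.+1 + h).+1%:R = 4 * h%:R - j%:R :> rat.
  by rewrite -natrM -natrB; [congr _%:R|]; lia.
by ring.
Qed.

(** The factor at [j = 2h - 1] is [p]; it is isolated to cancel the factor [2n + 1] of
    [term16_sum]. *)
Lemma prod_den16 h : \prod_(0 <= j < 3 * h) (3 * j%:R + 4)
  = (6 * h + 1)%N%:R * (\prod_(0 <= l < 2 * h) (1 * (6 * h + 1)%N%:R + - 3 * l.+1%:R)
     * \prod_(0 <= l < h) (1 * (6 * h + 1)%N%:R + 3 * l.+1%:R)) :> rat.
Proof.
have h23 : (2 * h <= 3 * h)%N by lia.
rewrite (big_cat_nat (leq0n _) h23) /= mulrA; congr (_ * _); last first.
  rewrite -{1}[(2 * h)%N]add0n big_addn; have -> : (3 * h - 2 * h = h)%N by lia.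
  by apply: eq_bigr => i _; ring.
pose f j : rat := (6 * h + 1)%N%:R - 3 * j%:R.
transitivity (\prod_(0 <= j < (2 * h).+1) f j).
  rewrite big_nat_recr //= big_nat_rev /= /f.
  (* An added factor equal to 1 completes the progression to length [2h]. *)
  have -> : (6 * h + 1)%N%:R - 3 * (2 * h)%N%:R = 1 :> rat by ring.
  rewrite mulr1; apply: eq_big_nat => j /andP[_ jh].
  rewrite natrB; last lia.
  by ring.
rewrite big_nat_recl // /f mulr0 subr0; congr (_ * _).
by apply: eq_bigr => j _; ring.
Qed.

Lemma prod_num256 h M : \prod_(h <= l < h + M) (5 * (6 * h + 1)%N%:R + - 12 * l.+1%:R)
  = \prod_(0 <= j < M) (6 * (3 * h)%N%:R - 7 - 12 * j%:R) :> rat.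
Proof.
rewrite -{1}[h]add0n big_addn addKn.
by apply: eq_bigr => i _; ring.
Qed.

(** The factor at [j = h] is [p]; those before it are [p + 12l], those after it [p - 12l]. *)
Lemma prod_den256 h m : \prod_(0 <= j < m.+1 + h) (6 * (3 * h)%N%:R + 1 - 12 * j%:R)
  = (6 * h + 1)%N%:R * (\prod_(0 <= l < h) (1 * (6 * h + 1)%N%:R + 12 * l.+1%:R)
     * \prod_(0 <= l < m) (1 * (6 * h + 1)%N%:R + - 12 * l.+1%:R)) :> rat.
Proof.
rewrite (big_cat_nat (leq0n _) (leq_addl _ _)) /= mulrCA; congr (_ * _).
  rewrite big_nat_rev /=; apply: eq_big_nat => j /andP[_ jh].
  rewrite natrB; last lia.
  by ring.
rewrite -{1}[h]add0n big_addn addnK big_nat_recl //; congr (_ * _).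
  by ring.
by apply: eq_bigr => j _; ring.
Qed.

Lemma signr_mul3 (S : pzRingType) h : (-1) ^+ (3 * h) = (-1) ^+ h :> S.
Proof. by rewrite -[LHS]signr_odd -[RHS]signr_odd oddM. Qed.

(** * The sums [S0], [S1] and [F] modulo [p^2] *)

Section Assembly.
Set Implicit Arguments. Unset Strict Implicit. Unset Printing Implicit Defensive.
Variables (R : comUnitRingType) (h n : nat).
Hypothesis n3 : n = (3 * h)%N.
Let p := (6 * h + 1)%N.
Hypothesis p_prime : prime p.
Let e : R := p%:R.
Hypothesis e2 : e * e = 0.
Hypothesis natU : forall m : nat, ~~ (p %| m)%N -> m%:R \is a @GRing.unit R.

Let h_gt0 : (0 < h)%N.
Proof. by have := p_prime; rewrite /p; case: (h). Qed.
Let ndvd m : (0 < m < p)%N -> ~~ (p %| m)%N.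
Proof. by case/andP=> m0 mp; rewrite gtnNdvd. Qed.
Let smallU m : (0 < m < p)%N -> m%:R \is a @GRing.unit R.
Proof. by move=> mp; apply/natU/ndvd. Qed.
Let nE : n%:R * 2 + 1 = e.
Proof. by rewrite /e -natrM natr1; congr _%:R; rewrite /p n3; lia. Qed.
Let npE : 2 * n%:R + 1 = p%:R :> rat.
Proof. by rewrite -natrM natr1; congr _%:R; rewrite /p n3; lia. Qed.

Let U32 (c : nat) : c \in [:: 2; 32]%N -> ~~ (p %| c)%N.
Proof.
have p2 : ~~ (p %| 2)%N by rewrite ndvd // /p; lia.
rewrite !inE => /orP[] /eqP-> //.
have -> : 32%N = (2 ^ 5)%N by [].
by rewrite Euclid_dvdX // (negPf p2).
Qed.

(* The common reduction of the summands binom(2k,k)^3 / (8 c)^k, c = 2 or 32,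
   and of their deformations. *)
Let alpha (c k : nat) : R :=
  \prod_(0 <= i < k) ((2 * i%:R + 1) ^+ 3 / (c * i.+1 ^ 3)%N%:R).

Let ndvd_den c i : c \in [:: 2; 32]%N -> (i < n)%N -> ~~ (p %| c * i.+1 ^ 3)%N.
Proof.
move=> c2 ik; rewrite Euclid_dvdM // negb_or U32 // Euclid_dvdX // negb_and orbF.
by apply: ndvd; rewrite /p; rewrite n3 in ik; lia.
Qed.

Lemma alpha_frac c i (y s : R) : c \in [:: 2; 32]%N -> (i < n)%N ->
  (2 * i%:R + 1) ^+ 3 * s = y * (c * i.+1 ^ 3)%N%:R ->
  (2 * i%:R + 1) ^+ 3 / (c * i.+1 ^ 3)%N%:R * s = y.
Proof.
move=> c2 ik E; have U := natU (ndvd_den c2 ik).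
by apply: (mulIr U); rewrite mulrAC divrK.
Qed.

(** Evenness in [p]: once denominators are cleared, the difference is a multiple of [(2n + 1)^2]. *)
Lemma ratio16_reduces i : (i < n)%N ->
  reduces p (ratio16 n i) ((2 * i%:R + 1) ^+ 3 / (2 * i.+1 ^ 3)%N%:R : R).
Proof.
move=> ik; apply: (@reduces_frac _ _ _ _ (- (2 * (i%:Z - n%:Z) * (i%:Z + n%:Z + 1) * (2 * i%:Z + 1)))
  ((i.+1 * (i + 2 * n + 2))%N%:Z * (2 * n%:Z - i%:Z))).
- have -> : 2 * n%:Z - i%:Z = (2 * n - i)%N%:Z by lia.
  have -> : (i + 2 * n + 2 = i.+1 + p)%N by rewrite /p n3; lia.
  rewrite abszM /= !Euclid_dvdM // dvdn_addl // !negb_or -andbA andbA andbb.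
  by rewrite !ndvd // /p; rewrite n3 in ik *; lia.
- rewrite /ratio16.
  have i0 : 0 <= i%:R :> rat by rewrite ler0n.
  have n0 : i%:R < n%:R :> rat by rewrite ltr_nat.
  by field; do ! (apply/andP; split); (apply: lt0r_neq0; lra) || (apply: ltr0_neq0; lra).
apply: alpha_frac => //; apply: (mulrI (natU (U32 (c := 2) isT))).
apply/eqP; rewrite -subr_eq0; apply/eqP; move: e2; rewrite -nE; set N := n%:R; set I := i%:R => E2.
transitivity ((N * 2 + 1) * (N * 2 + 1) * (2 * (2 * I + 1) * (I + 1) * ((2 * I + 1) ^+ 2 - (I + 1) ^+ 2))).
  by ring.
by rewrite E2 mul0r.
Qed.

Lemma ratio256_reduces i : (i < n)%N ->
  reduces p (ratio256 n i) ((2 * i%:R + 1) ^+ 3 / (32 * i.+1 ^ 3)%N%:R : R).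
Proof.
move=> ik; apply: (@reduces_frac _ _ _ _ (2 * (i%:Z - n%:Z) * (i%:Z + n%:Z + 1) * (2 * i%:Z + 1))
  ((i.+1)%N%:Z * (4 * i%:Z + 2 * n%:Z + 5) * (4 * i%:Z + 3 - 2 * n%:Z))).
- have p2 : ~~ (p %| 2)%N := U32 (c := 2) isT.
  have p4 : ~~ (p %| 4 * i.+1)%N.
    rewrite -[4%N]/(2 * 2)%N !Euclid_dvdM // (negPf p2) /= ndvd // /p.
    by rewrite n3 in ik; lia.
  rewrite !abszM !Euclid_dvdM // !negb_or -andbA; apply/and3P; split.
  - by rewrite /= ndvd // /p; rewrite n3 in ik; lia.
  - apply: contra p4.
    have -> : absz (4 * i%:Z + 2 * n%:Z + 5) = (4 * i.+1 + p)%N by rewrite /p n3; lia.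
    by rewrite dvdn_addl.
  - apply: contra p4 => H.
    (* This factor may be negative, so divisibility is tested on integers; adding [p] gives
       [4(i + 1)]. *)
    have : (p%:Z %| (4 * i%:Z + 3 - 2 * n%:Z) + p%:Z)%Z by rewrite rpredD // dvdzE.
    have -> : (4 * i%:Z + 3 - 2 * n%:Z) + p%:Z = (4 * i.+1)%N%:Z by rewrite /p n3; lia.
    by rewrite dvdzE.
- rewrite /ratio256.
  have h1 := odd_neq_mul4 n i.+1; rewrite -!natr1 in h1.
  have i0 : 0 <= i%:R :> rat by rewrite ler0n.
  have n0 : i%:R < n%:R :> rat by rewrite ltr_nat.
  field; do ! (apply/andP; split); try (apply: lt0r_neq0; lra).
  by move: h1; apply: contra_neq; lra.
apply: alpha_frac => //; apply: (mulrI (natU (U32 (c := 2) isT))).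
apply/eqP; rewrite -subr_eq0; apply/eqP; move: e2; rewrite -nE; set N := n%:R; set I := i%:R => E2.
transitivity ((N * 2 + 1) * (N * 2 + 1) * (2 * (2 * I + 1) * (I + 1)
   * (- (2 * I + 1) ^+ 2 + 16 * (I + 1) ^+ 2))).
  by ring.
by rewrite E2 mul0r.
Qed.

Lemma term16_reduces k : (k <= n)%N -> reduces p (term16 n k) (alpha 2 k).
Proof.
by move=> kn; apply: (reduces_prod p_prime) => i /andP[_ ik]; apply/ratio16_reduces/(leq_trans ik).
Qed.

Lemma term256_reduces k : (k <= n)%N -> reduces p (term256 n k) (alpha 32 k).
Proof.
by move=> kn; apply: (reduces_prod p_prime) => i /andP[_ ik]; apply/ratio256_reduces/(leq_trans ik).
Qed.

Lemma central_binomial_step k :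
  (k.+1 ^ 2 * 'C(k.+1.*2, k.+1) = 2 * k.+1 * ((2 * k + 1) * 'C(k.*2, k)))%N.
Proof.
have := mul_bin_down k.*2.+1 k; have := mul_bin_diag k.+1.*2 k.
rewrite doubleS /= => E1 E2.
have kE : (k.*2.+1 - k = k.+1)%N by lia.
by rewrite kE in E2; rewrite -mulnn -mulnA -E1; move: E2; rewrite -mul2n; nia.
Qed.

Lemma central_binomial_prod c k : (0 < c)%N ->
  ('C(k.*2, k) ^ 3)%N%:R / ((8 * c) ^ k)%N%:R
  = \prod_(0 <= i < k) ((2 * i%:R + 1) ^+ 3 / (c * i.+1 ^ 3)%N%:R) :> rat.
Proof.
move=> c0; elim: k => [|k IH]; first by rewrite big_geq // bin0 expn0 divr1.
rewrite big_nat_recr //= -IH.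
have c1 : c%:R != 0 :> rat by rewrite pnatr_eq0 -lt0n.
have k1 : k.+1%:R != 0 :> rat by rewrite pnatr_eq0.
have C : 'C(k.+1.*2, k.+1)%:R = 2 * (2 * k%:R + 1) * 'C(k.*2, k)%:R / k.+1%:R :> rat.
  have /(congr1 (fun m => m%:R : rat)) := central_binomial_step k.
  rewrite -mulnn !natrM natrD natrM => E.
  apply: (mulIf k1); apply: (mulIf k1); rewrite divfK //.
  by transitivity (k.+1%:R * k.+1%:R * 'C(k.+1.*2, k.+1)%:R : rat); [ring | rewrite E; ring].
rewrite (expnS (8 * c)) !natrM !natrX C natrM.
have X0 : (8 * c%:R) ^+ k != 0 :> rat by rewrite expf_neq0 // mulf_neq0.
move: k1; rewrite -natr1 => k1.
by field; rewrite k1 X0 c1.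
Qed.

Lemma central_reduces c k : c \in [:: 2; 32]%N -> (k <= n)%N ->
  reduces p (('C(k.*2, k) ^ 3)%N%:R / ((8 * c) ^ k)%N%:R) (alpha c k).
Proof.
move=> c2 kn; rewrite central_binomial_prod; last by move: c2; rewrite !inE => /orP[] /eqP->.
apply: (reduces_prod p_prime) => i /andP[_ ik].
apply: reduces_div_nat => //; first by rewrite ndvd_den // (leq_trans ik).
apply: reducesX => //; apply: reducesD => //; last exact: (reduces_nat R p_prime 1).
by apply: reducesM => //; [exact: (reduces_nat R p_prime 2) | exact: reduces_nat].
Qed.

Let S0 c : R := \sum_(0 <= k < n.+1) alpha c k.
Let S1 c : R := \sum_(0 <= k < n.+1) k%:R * alpha c k.
Let F c : R := \sum_(0 <= k < n.+1) alpha c k / k.+1%:R.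

(** This is [C(n,k) C(n+k,k) C(2k,k)] as a product of term ratios. *)
Let A k : rat := \prod_(0 <= i < k)
  (2 * (2 * i%:R + 1) * (n%:R - i%:R) * (n%:R + 1 + i%:R) / i.+1%:R ^+ 3).

(** At [t = -2/c], which is [-1] or [-1/16], the term ratio is
    [(2i+1)((2i+1)^2 - p^2) / (c(i+1)^3)]. *)
Lemma A_reduces c k : c \in [:: 2; 32]%N -> (k <= n)%N ->
  reduces p (A k * (- (2 / c%:R)) ^+ k) (alpha c k).
Proof.
move=> c2 kn.
have -> : A k * (- (2 / c%:R)) ^+ k = \prod_(0 <= i < k)
  (2 * (2 * i%:R + 1) * (n%:R - i%:R) * (n%:R + 1 + i%:R) / i.+1%:R ^+ 3 * (- (2 / c%:R))).
  by rewrite big_split /= prodr_const_nat subn0.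
apply: (reduces_prod p_prime) => i /andP[_ ik]; have {ik} ik := leq_trans ik kn.
have c0 : c%:R != 0 :> rat by move: c2; rewrite !inE => /orP[] /eqP->.
apply: (@reduces_frac _ _ _ _ (4 * (2 * i%:Z + 1) * (i%:Z - n%:Z) * (n%:Z + 1 + i%:Z))
  (c * i.+1 ^ 3)%N%:Z); first by rewrite /= ndvd_den.
  rewrite -pmulrn natrM natrX.
  have i0 : i.+1%:R != 0 :> rat by rewrite pnatr_eq0.
  by move: i0; rewrite -natr1 => i0; field; rewrite i0 c0.
apply: alpha_frac => //; set C := (c * _)%N%:R.
apply/eqP; rewrite -subr_eq0; apply/eqP; move: e2; rewrite -nE; set N := n%:R; set I := i%:R => E2.
transitivity ((N * 2 + 1) * (N * 2 + 1) * ((2 * I + 1) * C)).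
  by rewrite -pmulrn -/C /I /N; ring.
by rewrite E2 mul0r.
Qed.

(** Twice the first integral: [8n(n+1) = 2(p^2 - 1)] reduces to [-2], and [2(1 + 4t)/t = 8 - c]. *)
Lemma first_integral_mod c : c \in [:: 2; 32]%N ->
  2 * F c * S0 c = 2 * S0 c ^+ 2 + (8 - c%:R) * S1 c ^+ 2.
Proof.
move=> c2; pose t : rat := - (2 / c%:R).
have c0 : c%:R != 0 :> rat by move: c2; rewrite !inE => /orP[] /eqP->.
have t0 : t != 0 by rewrite oppr_eq0 mulf_neq0 ?invr_eq0.
have A_rec k : k.+1%:R ^+ 3 * A k.+1
    = 2 * (2 * k%:R + 1) * (n%:R * (n%:R + 1) - k%:R * (k%:R + 1)) * A k.
  rewrite /A big_nat_recr //=; have k0 : k%:R + 1 != 0 :> rat by rewrite natr1 pnatr_eq0.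
  by field; rewrite addrC.
have A_last k : (n < k)%N -> A k = 0.
  move=> nk; rewrite /A (big_cat_nat (leq0n n.+1) nk) /= big_nat_recr //= subrr.
  by rewrite mulr0 !mul0r mulr0 mul0r.
have := clausen_first_integral _ _ _ _ A_rec A_last t t0.
set f := \sum_(0 <= _ < _) (_ / _); set s0 := \sum_(0 <= _ < _) _; set s1 := \sum_(0 <= _ < _) _ => E.
have rf : reduces p f (F c).
  apply: (reduces_sum p_prime) => k /andP[_ kn]; apply: reduces_div_nat => //.
    by apply: ndvd; rewrite n3 in kn; rewrite /p; lia.
  exact: A_reduces.
have r0 : reduces p s0 (S0 c) by apply: (reduces_sum p_prime) => k /andP[_ kn]; exact: A_reduces.
have r1 : reduces p s1 (S1 c).
  apply: (reduces_sum p_prime) => k /andP[_ kn].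
  by apply: reducesM => //; [exact: reduces_nat | exact: A_reduces].
have rl : reduces p (8 * (n%:R * (n%:R + 1)) : rat) (- 2 : R).
  have -> : - 2 = 8 * (n%:R * (n%:R + 1)) :> R.
    have E2 : (n%:R * 2 + 1) * (n%:R * 2 + 1) = 0 :> R by rewrite nE.
    by transitivity (2 * ((n%:R * 2 + 1) * (n%:R * 2 + 1)) - 2 : R); [rewrite E2|]; ring.
  apply: reducesM => //; first exact: (reduces_nat R p_prime 8).
  apply: reducesM => //; first exact: reduces_nat.
  by rewrite !natr1; apply: reduces_nat.
have rc : reduces p (8 - c%:R : rat) (8 - c%:R : R).
  by apply: reducesB => //; [exact: (reduces_nat R p_prime 8) | exact: reduces_nat].
have E' : 8 * (n%:R * (n%:R + 1)) * f * s0
    = 8 * (n%:R * (n%:R + 1)) * s0 ^+ 2 - (8 - c%:R) * s1 ^+ 2.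
  have -> : 8 - c%:R = 2 * ((1 + 4 * t) / t).
    by rewrite /t; field; rewrite c0.
  by transitivity (2 * (4 * (n%:R * (n%:R + 1)) * f * s0)); [ring | rewrite E; ring].
have H : - 2 * F c * S0 c = - 2 * S0 c ^+ 2 - (8 - c%:R) * S1 c ^+ 2.
  apply: (reduces_fun natU (x := 8 * (n%:R * (n%:R + 1)) * f * s0)).
    by do 2 (apply: reducesM => //).
  by rewrite E'; apply: reducesB => //; apply: reducesM => //; apply: reducesX.
by apply: oppr_inj; transitivity (- 2 * F c * S0 c); [ring | rewrite H; ring].
Qed.

Lemma S_lin16 : S0 2 + 3 * S1 2 = e.
Proof.
apply: (reduces_fun natU (x := p%:R)); last exact: reduces_nat.
rewrite -npE -term16_lin_sum /S0 /S1 mulr_sumr -big_split /=.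
apply: (reduces_sum p_prime) => k /andP[_ kn].
have -> : alpha 2 k + 3 * (k%:R * alpha 2 k) = (3 * k%:R + 1) * alpha 2 k by ring.
apply: reducesM => //; last exact: term16_reduces.
apply: reducesD => //; last exact: (reduces_nat R p_prime 1).
by apply: reducesM => //; [exact: (reduces_nat R p_prime 3) | exact: reduces_nat].
Qed.

Lemma S_lin256 : S0 32 + 6 * S1 32 = (-1) ^+ n * e.
Proof.
apply: (reduces_fun natU (x := (-1) ^+ n * p%:R)); last first.
  apply: reducesM => //; last exact: reduces_nat.
  by apply: reducesX => //; apply: reducesN => //; exact: (reduces_nat R p_prime 1).
rewrite -npE -term256_lin_sum /S0 /S1 mulr_sumr -big_split /=.
apply: (reduces_sum p_prime) => k /andP[_ kn].
have -> : alpha 32 k + 6 * (k%:R * alpha 32 k) = (6 * k%:R + 1) * alpha 32 k by ring.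
apply: reducesM => //; last exact: term256_reduces.
apply: reducesD => //; last exact: (reduces_nat R p_prime 1).
by apply: reducesM => //; [exact: (reduces_nat R p_prime 6) | exact: reduces_nat].
Qed.

Lemma lin_prod_reduces (c d : int) (x y : R) a b : x = c%:~R -> y = d%:~R ->
  reduces p (\prod_(a <= l < b) (c%:~R * p%:R + d%:~R * l.+1%:R))
    (\prod_(a <= l < b) (x * e + y * l.+1%:R) : R).
Proof.
move=> -> ->.
apply: (reduces_prod p_prime) => l _; apply: reducesD => //; apply: reducesM => //;
  by [exact: reduces_int | exact: reduces_nat].
Qed.

Let V : R := 4 ^+ (8 * h * p) * jac R h ^+ 2.

(** The closed form is multiplied out over the rationals, with [p] cancelled there, before it is
    reduced. *)
Lemma S0_16 : S0 2 = V.
Proof.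
apply: (eval16_jac p_prime e2 natU); apply: (eval16 p_prime e2 natU).
set Y := \prod_(h <= l < 4 * h) _.
apply: (reduces_fun natU (s := Y)
  (x := \prod_(h <= l < 4 * h) (2 * p%:R + - 3 * l.+1%:R))); last first.
  by apply: (@lin_prod_reduces 2 (-3)).
have D0 : \prod_(0 <= j < n) (3 * j%:R + 4) != 0 :> rat.
  by rewrite prodf_seq_neq0; apply/allP => j _; apply/implyP => _; apply: lt0r_neq0; have := ler0n rat j; lra.
have -> : \prod_(h <= l < 4 * h) (2 * p%:R + - 3 * l.+1%:R)
   = (\sum_(0 <= k < n.+1) term16 n k)
     * (\prod_(0 <= l < 2 * h) (1 * p%:R + - 3 * l.+1%:R)
     * \prod_(0 <= l < h) (1 * p%:R + 3 * l.+1%:R)) :> rat.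
  rewrite prod_num16 term16_sum npE prodf_div -n3.
  move: D0; rewrite n3 prod_den16 -/p; set X := _ * \prod_(0 <= l < h) _ => D0.
  set Q := \prod_(0 <= j < _) _; transitivity (Q / (p%:R * X) * (p%:R * X)); last by ring.
  by rewrite divfK.
apply: reducesM => //.
  by apply: (reduces_sum p_prime) => k /andP[_ kn]; exact: term16_reduces.
by apply: reducesM => //; [apply: (@lin_prod_reduces 1 (-3)) | apply: (@lin_prod_reduces 1 3)].
Qed.

Lemma S0_256 : S0 32 = (-1) ^+ n * V.
Proof.
have [m mE] : exists m, uphalf (3 * h) = (m.+1 + h)%N by exists (uphalf (3 * h) - h.+1)%N; lia.
have -> : (-1) ^+ n = (-1) ^+ h :> R.
  by rewrite n3 signr_mul3.
apply: (eval256_jac p_prime e2 natU mE); apply: (eval256 p_prime e2 natU); first lia.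
set Y := \prod_(h <= l < _) _.
have sE : (-1) ^+ n = (-1) ^+ h :> rat.
  by rewrite n3 signr_mul3.
apply: (reduces_fun natU
  (x := (-1) ^+ h * \prod_(h <= l < h + (m.+1 + h)) (5 * p%:R + - 12 * l.+1%:R))); last first.
  apply: reducesM => //; last by apply: (@lin_prod_reduces 5 (-12)).
  by apply: reducesX => //; apply: reducesN => //; exact: (reduces_nat R p_prime 1).
have D0 : \prod_(0 <= j < m.+1 + h) (6 * (3 * h)%N%:R + 1 - 12 * j%:R) != 0 :> rat.
  rewrite prodf_seq_neq0; apply/allP => j _; apply/implyP => _.
  have := odd_neq_mul4 (9 * h) (3 * j); rewrite !natrM; apply: contra_neq; lra.
have -> : (-1) ^+ h * \prod_(h <= l < h + (m.+1 + h)) (5 * p%:R + - 12 * l.+1%:R)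
   = (\sum_(0 <= k < n.+1) term256 n k)
     * (\prod_(0 <= l < h) (1 * p%:R + 12 * l.+1%:R)
     * \prod_(0 <= l < m) (1 * p%:R + - 12 * l.+1%:R)) :> rat.
  rewrite prod_num256 term256_sum npE prodf_div sE n3 mE.
  move: D0; rewrite prod_den256 -/p; set X := _ * \prod_(0 <= l < m) _ => D0.
  set Q := \prod_(0 <= j < _) _.
  transitivity ((-1) ^+ h * (Q / (p%:R * X) * (p%:R * X))); last by ring.
  by rewrite divfK.
apply: reducesM => //.
  by apply: (reduces_sum p_prime) => k /andP[_ kn]; exact: term256_reduces.
by apply: reducesM => //; [apply: (@lin_prod_reduces 1 12) | apply: (@lin_prod_reduces 1 (-12))].
Qed.

Hypothesis natR_eq0 : forall m : nat, m%:R = 0 :> R -> (p ^ 2 %| m)%N.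

Let U2 : 2 \is a @GRing.unit R. Proof. apply: (smallU (m := 2)); rewrite /p; lia. Qed.
Let U3 : 3 \is a @GRing.unit R. Proof. apply: (smallU (m := 3)); rewrite /p; lia. Qed.

Let V_unit : V \is a GRing.unit.
Proof.
rewrite unitrM !unitrX ?jac_unit //.
by rewrite (natrM R 2 2) unitrM U2.
Qed.

(** Substituting [3 S1 = p - V] in the first integral gives [6 F V = (8V - 4p) V] with [V] a unit,
    and [V = 4x^2 - 2p = 2p - 12y^2]. *)
Lemma F_16 (x y : int) : p%:Z = x ^+ 2 + 3 * y ^+ 2 ->
  F 2 = - 16 * (y ^+ 2)%:~R + 2 * e.
Proof.
move=> px; have VE : V = 4 * (x ^+ 2)%:~R - 2 * e := jac_sq p_prime e2 natU natR_eq0 px.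
have eE : e = (x ^+ 2)%:~R + 3 * (y ^+ 2)%:~R.
  by transitivity ((p%:Z)%:~R : R); rewrite // px rmorphD rmorphM.
have E1 := first_integral_mod (c := 2) isT; have E3 := S_lin16; have E4 := S0_16.
rewrite E4 in E1 E3; set f := F 2 in E1 *; set s1 := S1 2 in E1 E3.
apply: (mulrI U3); apply: (mulrI U2); apply: (mulIr V_unit).
transitivity (3 * (2 * f * V)); first by ring.
rewrite E1; transitivity (6 * V ^+ 2 + 2 * (3 * s1) * (3 * s1)); first by ring.
have -> : 3 * s1 = e - V by rewrite -E3; ring.
transitivity ((8 * V - 4 * e) * V + 2 * (e * e)); first by ring.
have -> : 8 * V - 4 * e = 6 * (- 16 * (y ^+ 2)%:~R + 2 * e) by rewrite VE eE; ring.
by rewrite e2; ring.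
Qed.

(** With [s] the sign, [S0 = s V] and [6 S1 = s(p - V)] turn the first integral into
    [6 F = s(4V + 4p)]. *)
Lemma F_256 (x y : int) : p%:Z = x ^+ 2 + 3 * y ^+ 2 ->
  F 32 = (-1) ^+ n * (- 8 * (y ^+ 2)%:~R + 2 * e).
Proof.
move=> px; have VE : V = 4 * (x ^+ 2)%:~R - 2 * e := jac_sq p_prime e2 natU natR_eq0 px.
have eE : e = (x ^+ 2)%:~R + 3 * (y ^+ 2)%:~R.
  by transitivity ((p%:Z)%:~R : R); rewrite // px rmorphD rmorphM.
have E1 := first_integral_mod (c := 32) isT; have E3 := S_lin256; have E4 := S0_256.
rewrite E4 in E1 E3; set f := F 32 in E1 *; set s1 := S1 32 in E1 E3.
have ss : (-1) ^+ n * (-1) ^+ n = 1 :> R by rewrite -expr2 sqrr_sign.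
move: E1 E3 ss; set s := (-1) ^+ n => E1 E3 ss.
have sU : s \is a GRing.unit by rewrite unitrX ?unitrN1.
apply: (mulrI U3); apply: (mulrI U2); apply: (mulIr V_unit); apply: (mulIr sU).
transitivity (3 * (2 * f * (s * V))); first by ring.
rewrite E1; transitivity (6 * (s * V) ^+ 2 - 2 * (6 * s1) * (6 * s1)); first by ring.
have -> : 6 * s1 = s * e - s * V by rewrite -E3; ring.
transitivity ((s * s) * (4 * V + 4 * e) * V - 2 * (e * e) * (s * s)); first by ring.
rewrite e2 ss mulr0 mul0r subr0 mul1r.
transitivity ((s * s) * (2 * 3 * (- 8 * (y ^+ 2)%:~R + 2 * e)) * V); last by ring.
by rewrite ss mul1r VE eE; ring.
Qed.

Lemma F_reduces c : c \in [:: 2; 32]%N ->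
  reduces p (\sum_(0 <= k < n.+1)
    ('C(k.*2, k) ^ 3)%N%:R / (((8 * c) ^ k)%N%:R * (k.+1)%:R)) (F c).
Proof.
move=> c2; apply: (reduces_sum p_prime) => k /andP[_ kn].
rewrite invfM mulrA; apply: reduces_div_nat => //; last exact: central_reduces.
by apply: ndvd; rewrite n3 in kn; rewrite /p; lia.
Qed.
End Assembly.

Theorem theorem2p4 (p : nat) (x y : int) :
  prime p -> (p %% 3 = 1)%N -> (p%:Z = x ^+ 2 + 3 * y ^+ 2) ->
  rat_congr p 2
    (\sum_(0 <= k < (p.-1)./2.+1)
        ('C(k.*2, k) ^ 3)%N%:R / ((16 ^ k)%N%:R * (k.+1)%:R))
    (- 16 * (y ^+ 2)%:~R + 2 * p%:R)
  /\
  rat_congr p 2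
    (\sum_(0 <= k < (p.-1)./2.+1)
        ('C(k.*2, k) ^ 3)%N%:R / ((256 ^ k)%N%:R * (k.+1)%:R))
    ((-1) ^+ (p.-1)./2 * (- 8 * (y ^+ 2)%:~R + 2 * p%:R)).
Proof.
move=> pp p3 px.
have [h ph] : exists h, p = (6 * h + 1)%N.
  have p2 : odd p by case: (even_prime pp) p3 => [->|].
  by exists (p %/ 6)%N; lia.
have nE : (p.-1)./2 = (3 * h)%N by lia.
rewrite nE; move: pp px {p3 nE}; rewrite ph => {p ph}.
set p := (6 * h + 1)%N => pp px.
(* Needed for ['Z_(p ^ 2)] to be the ring of integers modulo [p^2]. *)
have p2 : (1 < p ^ 2)%N by rewrite (ltn_exp2l 0) ?prime_gt1.
pose R : comUnitRingType := 'Z_(p ^ 2).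
have natR m : m%:R = 0 :> R -> (p ^ 2 %| m)%N.
  by move/(congr1 val); rewrite /= val_Zp_nat // => /eqP.
have e2 : p%:R * p%:R = 0 :> R.
  by rewrite -natrM mulnn; apply: val_inj; rewrite /= val_Zp_nat // modnn.
have natU m : ~~ (p %| m)%N -> m%:R \is a @GRing.unit R.
  by move=> pm; rewrite unitZpE // coprimeXl // prime_coprime.
have rn (m : nat) : reduces p m%:R (m%:R : R) by exact: reduces_nat.
have ri (a : int) : reduces p a%:~R (a%:~R : R) by exact: reduces_int.
split; apply: (reduces_congr pp natR).
- exact: (F_reduces (erefl (3 * h)%N) pp natU (c := 2%N) isT).
- rewrite (F_16 (erefl (3 * h)%N) pp e2 natU natR px).
  apply: reducesD => //; apply: reducesM => //.
  by apply: reducesN => //; exact: (rn 16%N).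
- exact: (F_reduces (erefl (3 * h)%N) pp natU (c := 32%N) isT).
rewrite (F_256 (erefl (3 * h)%N) pp e2 natU natR px).
apply: reducesM => //.
  by apply: reducesX => //; apply: reducesN => //; exact: (rn 1%N).
apply: reducesD => //; apply: reducesM => //.
by apply: reducesN => //; exact: (rn 8%N).
Qed.
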